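(* Let $s\in(0,1)$, $N>2s$, let $\Omega\subset\mathbb{R}^N$ be a bounded domain with Lipschitz boundary, and let $k\ge2$. If $\lambda_k$ is a simple eigenvalue, then the region $\mathrm{II}_k$ is free of $\Sigma^s(\Omega)$, i.e. $\mathrm{II}_k\cap\Sigma^s(\Omega)=\emptyset$.
   Context: Let $X^s(\Omega)=\{u\in L^2(\mathbb{R}^N): \|u\|<\infty,\ u=0\text{ a.e. in }\mathbb{R}^N\setminus\Omega\}$, a Hilbert space with inner product $(u,v)=\int_{\mathbb{R}^{2N}}\frac{(u(x)-u(y))(v(x)-v(y))}{|x-y|^{N+2s}}\,dx\,dy$ and norm $\|u\|=(u,u)^{1/2}$. Write $u^\pm=\max\{\pm u,0\}$. $\Sigma^s(\Omega)$ (the Dancer-Fučík spectrum of $(-\Delta)^s$ in $\Omega$) is the set of all $(a,b)\in\mathbb{R}^2$ for which $(-\Delta)^su=bu^+-au^-$ in $\Omega$, $u=0$ in $\mathbb{R}^N\setminus\Omega$, has a nontrivial weak solution, i.e. there is $u\in X^s(\Omega)\setminus\{0\}$ with $(u,v)=\int_\Omega(bu^+-au^-)v\,dx$ for all $v\in X^s(\Omega)$. Let $0<\lambda_1<\lambda_2<\cdots$ be the distinct eigenvalues of $(-\Delta)^s$ in $\Omega$, i.e. the $\lambda$ for which there is $u\in X^s(\Omega)\setminus\{0\}$ with $(u,v)=\lambda\int_\Omega uv\,dx$ for all $v\in X^s(\Omega)$; let $E_k$ be the (finite dimensional) eigenspace of $\lambda_k$ ($\lambda_k$ is simple if $\dim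 E_k=1$), $N_k=\bigoplus_{j=1}^kE_j$, $M_k=N_k^\perp\cap X^s(\Omega)$ (orthogonality in $X^s(\Omega)$ and in $L^2(\Omega)$ give the same space), and $Q_k=(\lambda_{k-1},\lambda_{k+1})^2$. Let $I(u,a,b)=\frac12\|u\|^2-\frac12\int_\Omega\left[b(u^+)^2+a(u^-)^2\right]dx$ for $u\in X^s(\Omega)$. For $B\subset X^s(\Omega)$ put $\widetilde B=\{u\in B:\|u\|=1\}$. For $(a,b)\in Q_k$ set $$n_{k-1}(a,b)=\inf_{w\in\widetilde M_{k-1}}\ \sup_{v\in N_{k-1}}I(v+w,a,b),\qquad m_k(a,b)=\sup_{v\in\widetilde N_k}\ \inf_{w\in M_k}I(v+w,a,b),$$ and for $a\in(\lambda_{k-1},\lambda_{k+1})$ set $$\nu_{k-1}(a)=\sup\{b\in(\lambda_{k-1},\lambda_{k+1}):n_{k-1}(a,b)\ge0\},\qquad\mu_k(a)=\inf\{b\in(\lambda_{k-1},\lambda_{k+1}):m_k(a,b)\le0\}.$$ Finally, $\mathrm{II}_k=\{(a,b)\in Q_k:\nu_{k-1}(a)<b<\mu_k(a)\}$. *)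

(* Defs.v *)
From HB Require Import structures.
From mathcomp Require Import all_boot all_order all_algebra.
From mathcomp Require Import all_classical all_reals all_analysis.

Set Implicit Arguments.
Unset Strict Implicit.
Unset Printing Implicit Defensive.
Import Order.TTheory GRing.Theory Num.Theory.
Import numFieldNormedType.Exports.

Local Open Scope classical_set_scope.
Local Open Scope ring_scope.

Definition rV_display : measure_display. Proof. exact: default_measure_display. Qed.

(* 'rV[R]_n carries the sigma-algebra generated by the coordinates, i.e. the
   Borel sets of R^n. *)
Section rV_measurable.
Context {R : realType} (n : nat).

Let coors (i : 'I_n) (x : 'rV[R]_n) : R := x ord0 i.

Let rV_set0 : g_sigma_preimage coors set0.
Proof. exact: sigma_algebra0. Qed.

Let rV_setC A : g_sigma_preimage coors A -> g_sigma_preimage coors (~` A).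
Proof. exact: sigma_algebraC. Qed.

Let rV_bigcup (F : (set 'rV[R]_n)^nat) :
  (forall i, g_sigma_preimage coors (F i)) ->
  g_sigma_preimage coors (\bigcup_i (F i)).
Proof. exact: sigma_algebra_bigcup. Qed.

HB.instance Definition _ := @isMeasurable.Build rV_display
  'rV[R]_n (g_sigma_preimage coors) rV_set0 rV_setC rV_bigcup.

End rV_measurable.

Section rV_measurable_fun.
Context {R : realType}.

Lemma measurable_coor n (i : 'I_n) :
  measurable_fun [set: 'rV[R]_n] (fun x : 'rV[R]_n => x ord0 i).
Proof.
move=> _ Y mY; rewrite setTI; apply: sub_sigma_algebra => /=.
rewrite -bigcup_seq/=; exists i => /=; first by rewrite mem_index_enum.
by exists Y => //; rewrite setTI.
Qed.

Lemma measurable_fun_rV d (T : measurableType d) n (f : T -> 'rV[R]_n) :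
  (forall i, measurable_fun [set: T] (fun x => f x ord0 i)) ->
  measurable_fun [set: T] f.
Proof.
move=> mf _ Y mY.
have : preimage_set_system setT f measurable `<=` measurable.
  rewrite -g_sigma_preimage_comp.
  apply: smallest_sub; first exact: sigma_algebra_measurable.
  case: n f mf {Y mY} => [|n] f mf; first by rewrite big_ord0.
  rewrite -bigcup_mkord_ord; apply: bigcup_sub => i Ii.
  by move=> A [B mB <-]; exact: mf.
by apply; exists Y.
Qed.

End rV_measurable_fun.

(* The library proves this, but its instance of sigma-finiteness for \x is not
   found by unification: an instance for products of subprobabilities, declared
   earlier, has the same key. *)
Lemma product_measure_sigma_finite d1 d2 (T1 : measurableType d1)
    (T2 : measurableType d2) (R : realType) (m1 : {measure set T1 -> \bar R})
    (m2 : {sigma_finite_measure set T2 -> \bar R}) :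
  sigma_finite setT m1 -> sigma_finite setT m2 ->
  sigma_finite setT (m1 \x m2)%E.
Proof.
move=> /sigma_finiteP[F [TF ndF Foo]] /sigma_finiteP[G [TG ndG Goo]].
exists (fun n => F n `*` G n).
  rewrite -setXTT TF TG predeqE => -[x y]; split.
    move=> [/= [n _ Fnx] [k _ Gky]]; exists (maxn n k) => //; split.
    - by move: x Fnx; exact/subsetPset/ndF/leq_maxl.
    - by move: y Gky; exact/subsetPset/ndG/leq_maxr.
  by move=> [n _ []/= ? ?]; split; exists n.
move=> k; have [? ?] := Foo k; have [? ?] := Goo k.
split; first exact: measurableX.
by rewrite product_measure1E// lte_mul_pinfty// ge0_fin_numE.
Qed.

Definition rV_cons {R : realType} n (p : R * 'rV[R]_n) : 'rV[R]_n.+1 :=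
  \row_i oapp (p.2 ord0) p.1 (unlift ord0 i).

Definition rV_uncons {R : realType} n (x : 'rV[R]_n.+1) : R * 'rV[R]_n :=
  (x ord0 ord0, \row_j x ord0 (lift ord0 j)).

Section lebesgue_rV.
Context {R : realType}.

Lemma rV_consK n : cancel (@rV_cons R n) (@rV_uncons R n).
Proof.
move=> [a v]; rewrite /rV_uncons mxE unlift_none /=; congr (_, _).
by apply/rowP => j; rewrite !mxE liftK.
Qed.

Lemma measurable_rV_cons n : measurable_fun [set: R * 'rV[R]_n] (@rV_cons R n).
Proof.
apply: measurable_fun_rV => i; rewrite /rV_cons.
case: (unliftP ord0 i) => [j ->|->].
- rewrite (_ : (fun x => _) =
    (fun v : 'rV[R]_n => v ord0 j) \o (snd : R * 'rV[R]_n -> _)).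
    by apply: measurableT_comp => //; exact: measurable_coor.
  by apply/funext => x; rewrite !mxE liftK.
- rewrite (_ : (fun x => _) = (fst : R * 'rV[R]_n -> _)) //.
  by apply/funext => x; rewrite !mxE unlift_none.
Qed.

Lemma measurable_rV_uncons n :
  measurable_fun [set: 'rV[R]_n.+1] (@rV_uncons R n).
Proof.
apply/measurable_fun_pair => /=; first exact: measurable_coor.
apply: measurable_fun_rV => i.
under eq_fun do rewrite mxE.
exact: measurable_coor.
Qed.

Section step.
Context n (mu : {sigma_finite_measure set 'rV[R]_n -> \bar R}).

Definition lebesgue_rV_step : set 'rV[R]_n.+1 -> \bar R :=
  pushforward (lebesgue_measure \x mu)%E (@rV_cons R n).

Let step0 : lebesgue_rV_step set0 = 0%E.
Proof. by rewrite /lebesgue_rV_step /pushforward preimage_set0 measure0. Qed.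

Let step_ge0 A : (0 <= lebesgue_rV_step A)%E.
Proof. exact: (measure_ge0 (lebesgue_measure \x mu)%E). Qed.

Let step_sigma_additive : semi_sigma_additive lebesgue_rV_step.
Proof.
move=> F mF tF mUF; rewrite /lebesgue_rV_step /pushforward preimage_bigcup.
apply: measure_semi_sigma_additive.
- by move=> n'; rewrite -[X in measurable X]setTI; exact: measurable_rV_cons.
- apply/trivIsetP => /= i j _ _ ij; rewrite -preimage_setI.
  by move/trivIsetP : tF => /(_ _ _ _ _ ij) ->//; rewrite preimage_set0.
- by rewrite -preimage_bigcup -[X in measurable X]setTI; exact: measurable_rV_cons.
Qed.

HB.instance Definition _ := isMeasure.Build _ _ _
  lebesgue_rV_step step0 step_ge0 step_sigma_additive.

Let step_sigma_finite : sigma_finite setT lebesgue_rV_step.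
Proof.
have [F TF mF] :=
  product_measure_sigma_finite (sigma_finiteT lebesgue_measure) (sigma_finiteT mu).
exists (fun i => @rV_uncons R n @^-1` F i).
  by rewrite -preimage_bigcup -TF preimage_setT.
move=> i; have [mFi Fioo] := mF i; split.
  by rewrite -[X in measurable X]setTI; exact: measurable_rV_uncons.
rewrite /lebesgue_rV_step /pushforward -comp_preimage.
by rewrite (_ : _ \o _ = id) //; apply/funext => x /=; rewrite rV_consK.
Qed.

HB.instance Definition _ := Measure_isSigmaFinite.Build _ _ _
  lebesgue_rV_step step_sigma_finite.

End step.

Fixpoint lebesgue_rV n : {sigma_finite_measure set 'rV[R]_n -> \bar R} :=
  match n with
  | 0 => dirac (0 : 'rV[R]_0)
  | n.+1 => lebesgue_rV_step (lebesgue_rV n)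
  end.

(* This property characterizes Lebesgue measure on Borel sets. *)
Lemma lebesgue_rV_box n (A : 'I_n -> set R) :
  (forall i, measurable (A i)) ->
  lebesgue_rV n [set x | forall i, A i (x ord0 i)] =
  (\prod_(i < n) lebesgue_measure (A i))%E.
Proof.
elim: n A => [|n IHn] A mA.
  rewrite big_ord0 /= diracE.
  by rewrite mem_set //= => -[].
have mB : measurable [set x : 'rV[R]_n | forall i, A (lift ord0 i) (x ord0 i)].
  rewrite (_ : mkset _ = \bigcap_(i in [set: 'I_n])
      ((fun x : 'rV[R]_n => x ord0 i) @^-1` A (lift ord0 i))).
    apply: fin_bigcap_measurable => // i _.
    by rewrite -[X in measurable X]setTI; exact: measurable_coor.
  by apply/seteqP; split => x /= h i; [move=> _|]; exact: h.
rewrite big_ord_recl -IHn => [|i]; last exact: mA.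
rewrite -product_measure1E //=; last exact: mA.
rewrite /lebesgue_rV_step /pushforward.
rewrite (_ : _ @^-1` _ = A ord0 `*` [set x : 'rV[R]_n |
  forall i, A (lift ord0 i) (x ord0 i)]) //.
apply/seteqP; split => [[a v] /= h|[a v] /= [h0 h] i].
- split=> [|i]; first by have := h ord0; rewrite mxE unlift_none.
  by have := h (lift ord0 i); rewrite mxE liftK.
- by rewrite mxE; case: (unliftP ord0 i) => [j ->|->].
Qed.

End lebesgue_rV.

Section euclidean.
Context {R : realType} {N : nat}.
Implicit Types x y : 'rV[R]_N.

Definition dotr x y : R := \sum_(i < N) x ord0 i * y ord0 i.

(* The library norm on matrices is the sup norm, hence this definition. *)
Definition enorm x : R := Num.sqrt (dotr x x).

(* Near each boundary point p, Omega is the set of points lying strictly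
   above the graph of a Lipschitz function over the hyperplane orthogonal to a
   unit vector e. The N-th coordinate of x in a rotated frame is dotr x e, and
   the other ones are represented by x - dotr x e *: e; gamma is only evaluated
   on that hyperplane. *)
Definition lipschitz_boundary (Omega : set 'rV[R]_N) : Prop :=
  forall p, (closure Omega `\` interior Omega) p ->
  exists (e : 'rV[R]_N) (gamma : 'rV[R]_N -> R) (L r : R),
    [/\ enorm e = 1, 0 < r,
        (forall x y, `|gamma x - gamma y| <= L * enorm (x - y)) &
        forall x, enorm (x - p) < r ->
          (Omega x <-> gamma (x - dotr x e *: e) < dotr x e)].

End euclidean.

Definition bounded_domain {R : realType} {N : nat} (Omega : set 'rV[R]_N) :=
  [/\ open Omega, connected Omega, Omega !=set0 & bounded_set Omega].

Section fractional_laplacian.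
Context {R : realType} {N : nat}.
Implicit Types (s a b l : R) (Omega : set 'rV[R]_N) (u v w : 'rV[R]_N -> R).

Local Notation mu := (@lebesgue_rV R N).

(* Elements of X^s(Omega) are represented by functions, not by classes modulo
   equality almost everywhere; this is the relation "u = 0 in X^s(Omega)". *)
Definition ae_zero u : Prop := {ae mu, forall x, u x = 0}.

(* On the diagonal the numerator vanishes, and so does the quotient. *)
Definition gagliardo_integrand s u v (z : 'rV[R]_N * 'rV[R]_N) : R :=
  (u z.1 - u z.2) * (v z.1 - v z.2) / enorm (z.1 - z.2) `^ (N%:R + 2 * s).

Definition Xs s Omega : set ('rV[R]_N -> R) := [set u |
  [/\ u \in Lfun mu 2%:E,
      (\int[(mu \x mu)%E]_z (gagliardo_integrand s u u z)%:E < +oo)%E &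
      {ae mu, forall x, ~ Omega x -> u x = 0}]].

Definition Xdot s u v : R := \int[(mu \x mu)%E]_z gagliardo_integrand s u v z.

Definition Xnorm s u : R := Num.sqrt (Xdot s u u).

Definition dancer_fucik s Omega : set (R * R) := [set ab |
  exists2 u, Xs s Omega u /\ ~ ae_zero u &
    forall v, Xs s Omega v ->
      Xdot s u v =
      \int[mu]_(x in Omega) ((ab.2 * u^\+ x - ab.1 * u^\- x) * v x)].

Definition fracl_eigenspace s Omega l : set ('rV[R]_N -> R) := [set u |
  Xs s Omega u /\
  forall v, Xs s Omega v ->
    Xdot s u v = l * \int[mu]_(x in Omega) (u x * v x)].

Definition fracl_eigenvalue s Omega l : Prop :=
  exists2 u, fracl_eigenspace s Omega l u & ~ ae_zero u.

(* lam 1 < lam 2 < ... are the distinct eigenvalues; lam 0 is unused. *)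
Definition eigenvalue_sequence s Omega (lam : nat -> R) : Prop :=
  [/\ 0 < lam 1%N,
      (forall j, (0 < j)%N -> lam j < lam j.+1) &
      forall l, fracl_eigenvalue s Omega l <-> exists2 j, (0 < j)%N & lam j = l].

(* V modulo equality almost everywhere has dimension d *)
Definition has_dim (V : set ('rV[R]_N -> R)) (d : nat) : Prop :=
  exists e : 'I_d -> 'rV[R]_N -> R,
    [/\ forall i, V (e i),
        (forall c : 'I_d -> R, ae_zero (fun x => \sum_i c i * e i x) ->
           forall i, c i = 0) &
        forall u, V u -> exists c : 'I_d -> R,
           ae_zero (fun x => u x - \sum_i c i * e i x)].

Definition simple_eigenvalue s Omega l : Prop :=
  fracl_eigenvalue s Omega l /\ has_dim (fracl_eigenspace s Omega l) 1.

Section linking.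
Variables (s : R) (Omega : set 'rV[R]_N) (lam : nat -> R).
Implicit Types (j k : nat) (B : set ('rV[R]_N -> R)).

Definition Nspace j : set ('rV[R]_N -> R) := [set u |
  exists2 e : nat -> 'rV[R]_N -> R,
    (forall i, (0 < i <= j)%N -> fracl_eigenspace s Omega (lam i) (e i)) &
    u = (fun x => \sum_(1 <= i < j.+1) e i x)].

Definition Mspace j : set ('rV[R]_N -> R) := [set w |
  Xs s Omega w /\ forall v, Nspace j v -> Xdot s w v = 0].

Definition unit_part B : set ('rV[R]_N -> R) :=
  [set u | B u /\ Xnorm s u = 1].

Definition Ifun u a b : R :=
  2^-1 * Xnorm s u ^+ 2 -
  2^-1 * \int[mu]_(x in Omega) (b * u^\+ x ^+ 2 + a * u^\- x ^+ 2).

(* Suprema and infima are taken in the extended reals, so that they exist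
   without any boundedness or nonemptiness assumption. *)
Definition n_val j a b : \bar R :=
  ereal_inf [set ereal_sup [set (Ifun (v \+ w) a b)%:E | v in Nspace j]
            | w in unit_part (Mspace j)].

Definition m_val j a b : \bar R :=
  ereal_sup [set ereal_inf [set (Ifun (v \+ w) a b)%:E | w in Mspace j]
            | v in unit_part (Nspace j)].

Definition Qsquare k : set (R * R) := [set ab |
  lam k.-1 < ab.1 < lam k.+1 /\ lam k.-1 < ab.2 < lam k.+1].

(* nu_lower k and mu_upper k stand for nu_(k-1) and mu_k *)
Definition nu_lower k a : \bar R :=
  ereal_sup [set b%:E | b in
    [set b | lam k.-1 < b < lam k.+1 /\ (0 <= n_val k.-1 a b)%E]].

Definition mu_upper k a : \bar R :=
  ereal_inf [set b%:E | b in
    [set b | lam k.-1 < b < lam k.+1 /\ (m_val k a b <= 0)%E]].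

Definition region_II k : set (R * R) := [set ab |
  Qsquare k ab /\
  (nu_lower k ab.1 < (ab.2)%:E)%E /\ ((ab.2)%:E < mu_upper k ab.1)%E].

End linking.

End fractional_laplacian.

(* Main.v *)
Require Import Defs.
From mathcomp Require Import all_boot all_order all_algebra.
From mathcomp Require Import all_classical all_reals all_analysis.
From mathcomp Require Import measurable_realfun ring lra.

Set Implicit Arguments.
Unset Strict Implicit.
Unset Printing Implicit Defensive.
Import Order.TTheory GRing.Theory Num.Theory.
Import numFieldNormedType.Exports.

Local Open Scope classical_set_scope.
Local Open Scope ring_scope.

(* Let (a, b) be in II_k, so that n_{k-1}(a, b) < 0 < m_k(a, b): there are z in
   M_{k-1} with I(v + z) < 0 for all v in N_{k-1}, and p in N_k with
   I(p + w) > 0 for all w in M_k.  A nontrivial solution u is a critical point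
   of I with I(u) = 0.  Since a and b lie strictly between lambda_{k-1} and
   lambda_{k+1}, I decreases from u along N_{k-1} and increases along M_k.
   As E_k is spanned by one function phi, each of u, z, p has one coordinate
   along phi; by the positive homogeneity of I, if two of these coordinates had
   the same sign, rescaling one of the two points would produce a point where I
   has contradictory signs, and a zero coordinate is excluded likewise.  Three
   nonzero reals cannot have pairwise opposite signs.

   The spectral input is lambda_{k+1} |w|^2 <= ||w||^2 on M_k: the infimum of
   the Rayleigh quotient on M_k is attained, hence an eigenvalue.  Compactness
   enters as an inequality |u|^2 <= e ||u||^2 + sum_i l_i(u)^2 with finitely
   many functionals, which for X^s comes from the Poincare inequality on small
   cubes, the l_i being normalized integrals over the cubes. *)

(** * Positive semidefinite forms *)

Section real_facts.
Context {R : realType}.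

(** For [a > 0] the value at the vertex [- b / a] is [(a * c - b ^+ 2) / a]; for [a = 0] and
    [b != 0] the chosen [t] gives the value -1. *)
Lemma quadratic_ge0_discr (a b c : R) : 0 <= a ->
  (forall t, 0 <= a * t ^+ 2 + 2 * b * t + c) -> b ^+ 2 <= a * c.
Proof.
move=> a0 h; have [a00|an0] := eqVneq a 0.
- have [->|b0] := eqVneq b 0; first by rewrite a00 expr0n mul0r.
  have := h (- (c + 1) / (2 * b)).
  have -> : 2 * b * (- (c + 1) / (2 * b)) = - (c + 1) by field; rewrite b0.
  by rewrite a00; lra.
- have {}a0 : 0 < a by rewrite lt_neqAle eq_sym an0.
  have := h (- b / a); have -> : a * (- b / a) ^+ 2 + 2 * b * (- b / a) + c =
    (a * c - b ^+ 2) / a by field.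
  by rewrite pmulr_lge0 ?invr_gt0 // subr_ge0.
Qed.

(** Identities satisfied by limits are proved below by bounding the square of the defect by a
    multiple of [16 ^- n]. *)
Lemma le_geometric_le0 (x C : R) : (forall n, x <= C * 16 ^- n) -> x <= 0.
Proof.
move=> h; have c0 : geometric C (16^-1 : R) n @[n --> \oo] --> (0 : R).
  by apply: cvg_geometric; rewrite ger0_norm; lra.
rewrite -(cvg_lim _ c0) //; apply: limr_ge; first exact: cvgP c0.
by apply: nearW => n /=; rewrite exprVn.
Qed.

Lemma geometric_le n m : (n <= m)%N -> 16 ^- m <= 16 ^- n :> R.
Proof. by move=> nm; rewrite lef_pV2 ?posrE ?exprn_gt0 // ler_eXn2l // ltr1n. Qed.

End real_facts.

Section forms.
Context {R : realType} {V : lmodType R}.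
Implicit Types (X W Y : set V) (B D L : V -> V -> R).

Definition subspace X :=
  X 0 /\ forall (c : R) u v, X u -> X v -> X (c *: u + v).

(** Nonzero null vectors are allowed: elements of $X^s(\Omega)$ are functions rather than classes,
    so the forms vanish on any function that is zero almost everywhere. *)
Record psd_form X B : Prop := PsdForm {
  form_lin : forall c u v w, X u -> X v -> X w ->
    B (c *: u + v) w = c * B u w + B v w;
  form_sym : forall u v, X u -> X v -> B u v = B v u;
  form_ge0 : forall u, X u -> 0 <= B u u }.

(* The rate 16^-n makes fast Cauchy sequences converge almost everywhere when
   the form is an L^2 inner product. *)
Definition complete_form X B := forall u_ : nat -> V, (forall n, X (u_ n)) ->
  (forall n m, (n <= m)%N -> B (u_ m - u_ n) (u_ m - u_ n) <= 16 ^- n) ->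
  exists2 u, X u & forall n, B (u - u_ n) (u - u_ n) <= 16 ^- n.

Definition closed_for X B W := forall u_ u, (forall n, W (u_ n)) -> X u ->
  (forall n, B (u - u_ n) (u - u_ n) <= 16 ^- n) -> W u.

Section subspace_theory.
Context {X} (sX : subspace X).

Lemma subspace0 : X 0. Proof. exact: sX.1. Qed.

Lemma subspaceZ c u : X u -> X (c *: u).
Proof. by move=> Xu; rewrite -[_ *: _]addr0; apply: sX.2 => //; exact: sX.1. Qed.

Lemma subspaceD u v : X u -> X v -> X (u + v).
Proof. by move=> Xu Xv; rewrite -[u]scale1r; exact: sX.2. Qed.

Lemma subspaceN u : X u -> X (- u).
Proof. by move=> Xu; rewrite -scaleN1r; exact: subspaceZ. Qed.

Lemma subspaceB u v : X u -> X v -> X (u - v).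
Proof. by move=> Xu Xv; apply: subspaceD => //; exact: subspaceN. Qed.

Lemma subspace_sum I (r : seq I) (P : pred I) (F : I -> V) :
  (forall i, P i -> X (F i)) -> X (\sum_(i <- r | P i) F i).
Proof. by move=> XF; elim/big_ind : _ => //; [exact: subspace0|exact: subspaceD]. Qed.

Context {B} (fB : psd_form X B).

Lemma formDl u v w : X u -> X v -> X w -> B (u + v) w = B u w + B v w.
Proof. by move=> *; rewrite -{1}[u]scale1r (form_lin fB) // mul1r. Qed.

Lemma form0l w : X w -> B 0 w = 0.
Proof.
move=> Xw; have := formDl subspace0 subspace0 Xw.
by rewrite addr0 => /eqP; rewrite -subr_eq subrr eq_sym => /eqP.
Qed.

Lemma formZl c u w : X u -> X w -> B (c *: u) w = c * B u w.
Proof.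
move=> Xu Xw; rewrite -[_ *: _]addr0 (form_lin fB) //; last exact: subspace0.
by rewrite form0l // addr0.
Qed.

Lemma formNl u w : X u -> X w -> B (- u) w = - B u w.
Proof. by move=> *; rewrite -scaleN1r formZl // mulN1r. Qed.

Lemma formBl u v w : X u -> X v -> X w -> B (u - v) w = B u w - B v w.
Proof. by move=> Xu Xv Xw; rewrite formDl ?formNl //; exact: subspaceN. Qed.

Lemma formDr u v w : X u -> X v -> X w -> B w (u + v) = B w u + B w v.
Proof.
by move=> Xu Xv Xw; rewrite !(form_sym fB Xw) ?formDl //; exact: subspaceD.
Qed.

Lemma formZr c u w : X u -> X w -> B w (c *: u) = c * B w u.
Proof.
by move=> Xu Xw; rewrite (form_sym fB) ?formZl ?(form_sym fB Xw) //;
  exact: subspaceZ.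
Qed.

Lemma form_sum I (r : seq I) (P : pred I) (F : I -> V) w :
  (forall i, P i -> X (F i)) -> X w ->
  B (\sum_(i <- r | P i) F i) w = \sum_(i <- r | P i) B (F i) w.
Proof.
move=> XF Xw; suff [] : X (\sum_(i <- r | P i) F i) /\
    B (\sum_(i <- r | P i) F i) w = \sum_(i <- r | P i) B (F i) w by [].
apply: (big_rec2 (fun x y => X x /\ B x w = y)).
  by split; [exact: subspace0|exact: form0l].
move=> i y x Pi [Xx <-]; split; first by apply: subspaceD => //; exact: XF.
by rewrite formDl //; exact: XF.
Qed.

Lemma form_sqZD c u v : X u -> X v ->
  B (c *: u + v) (c *: u + v) = c ^+ 2 * B u u + 2 * c * B u v + B v v.
Proof.
move=> Xu Xv; have Xcu := subspaceZ c Xu.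
rewrite formDl ?formDr ?formZl ?formZr //; last exact: subspaceD.
by rewrite (form_sym fB Xv) //; ring.
Qed.

Lemma form_sqZ c u : X u -> B (c *: u) (c *: u) = c ^+ 2 * B u u.
Proof.
move=> Xu; have := form_sqZD c Xu subspace0.
rewrite addr0 (form_sym fB Xu) //; last exact: subspace0.
by rewrite !form0l ?mulr0 ?addr0 //; exact: subspace0.
Qed.

Lemma form_sqD u v : X u -> X v ->
  B (u + v) (u + v) = B u u + 2 * B u v + B v v.
Proof. by move=> Xu Xv; have := form_sqZD 1 Xu Xv; rewrite scale1r => ->; ring. Qed.

Lemma form_sqB u v : X u -> X v ->
  B (u - v) (u - v) = B u u - 2 * B u v + B v v.
Proof.
move=> Xu Xv; have := form_sqZD (-1) Xv Xu.
by rewrite scaleN1r addrC (form_sym fB Xv) // => ->; ring.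
Qed.

Lemma form_parallelogram u v : X u -> X v ->
  B (u - v) (u - v) = 2 * B u u + 2 * B v v - B (u + v) (u + v).
Proof. by move=> Xu Xv; rewrite form_sqB // form_sqD //; ring. Qed.

(** The polynomial [t -> B (t *: u + v) (t *: u + v)] is nonnegative, so its discriminant is not
    positive. *)
Lemma form_CS u v : X u -> X v -> B u v ^+ 2 <= B u u * B v v.
Proof.
move=> Xu Xv; apply: quadratic_ge0_discr; first exact: (form_ge0 fB).
move=> t; rewrite (_ : _ + _ = B (t *: u + v) (t *: u + v)); last first.
  by rewrite form_sqZD //; ring.
by apply: (form_ge0 fB); apply: subspaceD => //; exact: subspaceZ.
Qed.

Lemma form_eq0 u v : X u -> X v -> B u u = 0 -> B u v = 0.
Proof.
move=> Xu Xv u0; have := form_CS Xu Xv; rewrite u0 mul0r => uv.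
by apply/eqP; rewrite -sqrf_eq0 eq_le uv sqr_ge0.
Qed.

(** A minimizing sequence for the distance from [u] to [W] is Cauchy by the parallelogram law, and
    the first variation along it tends to zero; its limit is the projection. *)
Lemma closed_projection W : complete_form X B ->
  subspace W -> W `<=` X -> closed_for X B W ->
  forall u, X u -> exists2 e, W e & forall f, W f -> B (u - e) f = 0.
Proof.
move=> cX sW WX cW u Xu.
pose S := [set B (u - e) (u - e) | e in W].
have S_ge0 x : S x -> 0 <= x.
  by move=> [e We <-]; apply: (form_ge0 fB); apply: subspaceB => //; exact: WX.
have lbS : has_lbound S by exists 0 => x; exact: S_ge0.
have infS : has_inf S.
  by split => //; exists (B (u - 0) (u - 0)); exists 0 => //; exact: sW.1.
pose d := inf S.
have dP e : W e -> d <= B (u - e) (u - e).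
  by move=> We; apply: ge_inf => //; exists e.
(* With an excess of a quarter of [16 ^- n] over [d], the parallelogram law, which multiplies it by
   four, gives the rate [16 ^- n] for [e_]. *)
have /choice[e_ eP] n : exists e, W e /\ B (u - e) (u - e) < d + 16 ^- n / 4.
  have e4 : 0 < 16 ^- n / 4 :> R by rewrite divr_gt0 // invr_gt0 exprn_gt0.
  by have [_ [e We <-] ?] := inf_adherent e4 infS; exists e.
have We n := (eP n).1; have Xe n := WX _ (We n).
have Xue n : X (u - e_ n) by exact: subspaceB.
(* The squared distance from [u] to [e_ n - t *: f], minus [d], is a nonnegative polynomial in [t],
   whose discriminant is used. *)
have near_min n f : W f -> B (u - e_ n) f ^+ 2 <= B f f * (16 ^- n / 4).
  move=> Wf; have Xf := WX _ Wf; apply: quadratic_ge0_discr => [|t].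
    exact: (form_ge0 fB).
  have : d <= B (u - ((- t) *: f + e_ n)) (u - ((- t) *: f + e_ n)).
    by apply: dP; exact: sW.2.
  rewrite (_ : u - _ = t *: f + (u - e_ n)); last first.
    by rewrite opprD scaleNr opprK addrCA.
  rewrite form_sqZD // (form_sym fB Xf) //; have := (eP n).2; lra.
have [e Xe' eE] : exists2 e, X e &
    forall n, B (e - e_ n) (e - e_ n) <= 16 ^- n.
  apply: cX => // n m nm.
  have W2 : W (2^-1 *: (e_ m + e_ n)).
    rewrite -[_ *: _]addr0; apply: sW.2; last exact: sW.1.
    by rewrite -[e_ m]scale1r; exact: sW.2.
  have := dP _ W2.
  have half : u - 2^-1 *: (e_ m + e_ n) =
      2^-1 *: ((u - e_ m) + (u - e_ n)).
    rewrite addrACA -opprD scalerBr -[u + u]mulr2n -[u *+ 2]scaler_nat scalerA.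
    by rewrite mulVf ?scale1r // pnatr_eq0.
  rewrite half form_sqZ; last exact: subspaceD.
  rewrite (form_sqD (Xue m) (Xue n)).
  have -> : e_ m - e_ n = (u - e_ n) - (u - e_ m).
    by rewrite opprB addrCA addrAC subrr add0r addrC.
  rewrite (form_sqB (Xue n) (Xue m)) (form_sym fB (Xue n) (Xue m)).
  have := (eP n).2; have := (eP m).2.
  have := @geometric_le R _ _ nm.
  lra.
exists e; first exact: cW eE.
move=> f Wf; have Xf := WX _ Wf; apply/eqP; rewrite -sqrf_eq0 eq_le sqr_ge0 andbT.
apply: (@le_geometric_le0 _ _ (B f f * 4)) => n.
have -> : u - e = (u - e_ n) - (e - e_ n).
  by rewrite opprB addrA subrK.
have Xee : X (e - e_ n) by exact: subspaceB.
rewrite formBl //; have := near_min n f Wf; have := form_CS Xee Xf.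
have := eE n; have : 0 <= B f f by exact: (form_ge0 fB).
set p := B (u - e_ n) f; set q := B (e - e_ n) f; set x := B (e - _) _.
have : 0 <= (p + q) ^+ 2 by exact: sqr_ge0.
set r := 16 ^- n; nra.
Qed.

End subspace_theory.
End forms.

(** * Minimizing the Rayleigh quotient *)

(** By compactness of the segment, [l] clusters at some [p] along [F]. Either the points where [l]
    is near [p] form a member of [F], or their complement does, and the latter contradicts
    clustering at [p]. *)
Lemma ultra_small_oscillation {R : realType} (T : Type) (F : set_system T)
    (l : T -> R) (c eta : R) : UltraFilter F -> 0 < eta ->
  F [set u | `|l u| <= c] ->
  exists2 A, F A & forall u v, A u -> A v -> `|l u - l v| < eta.
Proof.
move=> FU eta0 Fc.
have Fl : (l @ F) `[- c, c]%classic.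
  suff H : [set u | `|l u| <= c] `<=` l @^-1` `[- c, c] by exact: (filterS H Fc).
  by move=> u /=; rewrite ler_norml in_itv.
have [p [_ clp]] := @segment_compact R (- c) c (l @ F) _ Fl.
pose A := [set u | `|l u - p| < eta / 2].
have [FA|FnA] := in_ultra_setVsetC A FU.
  exists A => // u v; rewrite /A /= => Au Av.
  have -> : l u - l v = (l u - p) - (l v - p) by ring.
  by rewrite (le_lt_trans (ler_normB _ _)) //; lra.
have lnA : (l @ F) (l @` ~` A).
  have H : ~` A `<=` l @^-1` (l @` ~` A) by move=> u nAu; exists u.
  exact: (filterS H FnA).
have [|x [[u nAu <-]]] := clp _ (ball p (eta / 2)) lnA.
  by apply: nbhsx_ballx; lra.
by rewrite /ball /= distrC.
Qed.

Section rayleigh.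
Context {R : realType} {V : lmodType R}.
Implicit Types (X W Y : set V) (B D L : V -> V -> R).

(** In the application [D] is the Gagliardo form and [L] the $L^2(\Omega)$ product; completeness
    holds for their sum. *)
Definition form_add D L : V -> V -> R := fun u v => D u v + L u v.

Lemma psd_form_add X D L : psd_form X D -> psd_form X L ->
  psd_form X (form_add D L).
Proof.
move=> fD fL; split=> [c u v w Xu Xv Xw|u v Xu Xv|u Xu]; rewrite /form_add.
- by rewrite (form_lin fD) // (form_lin fL) //; ring.
- by rewrite (form_sym fD) // (form_sym fL).
- by rewrite addr_ge0 //; [exact: (form_ge0 fD)|exact: (form_ge0 fL)].
Qed.

(** This expresses compactness of the embedding into $L^2$: a [D]-bounded set on which finitely many
    functionals oscillate little has a small [L]-diameter. *)
Definition compact_form X D L := forall e, 0 < e ->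
  exists (I : finType) (l : I -> V -> R),
  [/\ forall i u v, X u -> X v -> l i (u - v) = l i u - l i v,
      forall i, exists C, forall u, X u -> l i u ^+ 2 <= C * L u u &
      forall u, X u -> L u u <= e * D u u + \sum_i l i u ^+ 2].

(** For [Y = X] this is the eigenspace of [c]; for [c = 0] it is the [D]-orthogonal complement of
    [Y] in [X]. Both are thus handled by the same lemmas. *)
Definition eigenset X D L Y (c : R) := [set u | X u /\
  forall v, Y v -> D u v = c * L u v].

Context X D L (sX : subspace X) (fD : psd_form X D) (fL : psd_form X L).

Lemma eigenset_subspace Y c : Y `<=` X -> subspace (eigenset X D L Y c).
Proof.
move=> YX; split.
  split=> [|v Yv]; first exact: subspace0.
  by rewrite (form0l sX fD) ?(form0l sX fL) ?mulr0 //; exact: YX.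
move=> a u v [Xu uE] [Xv vE]; split; first exact: sX.2.
move=> w Yw; have Xw := YX _ Yw.
by rewrite (form_lin fD) // (form_lin fL) // uE // vE //; ring.
Qed.

(** The defect [D u v - c * L u v] is unchanged when [u] is replaced by [u - u_ n], and is then
    controlled by Cauchy-Schwarz in each form. *)
Lemma eigenset_closed Y c : Y `<=` X ->
  closed_for X (form_add D L) (eigenset X D L Y c).
Proof.
move=> YX u_ u uE Xu u_u; split => // v Yv; have Xv := YX _ Yv.
apply/eqP; rewrite -subr_eq0 -sqrf_eq0 eq_le sqr_ge0 andbT.
apply: (@le_geometric_le0 _ _ (2 * D v v + 2 * c ^+ 2 * L v v)) => n.
have Xn := (uE n).1; have Xh : X (u - u_ n) by exact: subspaceB.
have -> : D u v - c * L u v = D (u - u_ n) v - c * L (u - u_ n) v.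
  rewrite (formBl sX fD) // (formBl sX fL) // (uE n).2 //; ring.
have := u_u n; rewrite /form_add.
have := form_CS sX fD Xh Xv; have := form_CS sX fL Xh Xv.
have := form_ge0 fD Xh; have := form_ge0 fL Xh.
have := form_ge0 fD Xv; have := form_ge0 fL Xv.
set a := D (u - _) v; set b := L (u - _) v; set r := 16 ^- n.
set dv := D v v; set lv := L v v; set dh := D _ _; set lh := L _ _.
move=> lv0 dv0 lh0 dh0 hb ha hr.
have a2 : a ^+ 2 <= r * dv by nra.
have b2 : b ^+ 2 <= r * lv by nra.
have cb2 : c ^+ 2 * b ^+ 2 <= c ^+ 2 * (r * lv) by rewrite ler_wpM2l ?sqr_ge0.
by have : 0 <= (a + c * b) ^+ 2 := sqr_ge0 _; lra.
Qed.

Hypothesis XC : complete_form X (form_add D L).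
Hypothesis XK : compact_form X D L.

(* The parallelogram law turns L-Cauchy into D-Cauchy along a minimizing filter
   of the Rayleigh quotient D/L. *)
Lemma rayleigh_min Y : Y `<=` X ->
  (exists2 w, eigenset X D L Y 0 w & 0 < L w w) ->
  exists (c : R) (u : V), [/\ eigenset X D L Y 0 u, L u u = 1,
    (forall v, eigenset X D L Y 0 v -> D u v = c * L u v) &
    forall v, eigenset X D L Y 0 v -> c * L v v <= D v v].
Proof.
move=> YX; set W := eigenset _ _ _ _ _; have sW : subspace W.
  exact: eigenset_subspace.
have WX : W `<=` X by move=> ? [].
move=> [w0 Ww0 w0_gt0].
pose S := [set D w w | w in [set w | W w /\ L w w = 1]].
have normalize w : W w -> 0 < L w w ->
    exists2 t, 0 < t & L w w = t ^+ 2 /\ W (t^-1 *: w) /\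
      L (t^-1 *: w) (t^-1 *: w) = 1 /\
      D (t^-1 *: w) (t^-1 *: w) = t ^- 2 * D w w.
  move=> Ww w_gt0; have Xw := WX _ Ww.
  have t0 : 0 < Num.sqrt (L w w) by rewrite sqrtr_gt0.
  exists (Num.sqrt (L w w)) => //.
  rewrite (form_sqZ sX fD) // (form_sqZ sX fL) // exprVn sqr_sqrtr ?ltW //.
  rewrite mulVf ?lt0r_neq0 //.
  by split=> //; split=> //; exact: (subspaceZ sW).
have S_ge0 x : S x -> 0 <= x.
  by move=> [e [We _] <-]; apply: (form_ge0 fD); exact: WX.
have infS : has_inf S.
  split; last by exists 0 => x; exact: S_ge0.
  have [t _ [_ [Wt [Lt _]]]] := normalize _ Ww0 w0_gt0.
  by exists (D (t^-1 *: w0) (t^-1 *: w0)); exists (t^-1 *: w0).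
pose c := inf S.
have cP v : W v -> c * L v v <= D v v.
  move=> Wv; have Xv := WX _ Wv; have := form_ge0 fL Xv.
  rewrite le_eqVlt => /predU1P[<-|v_gt0].
    by rewrite mulr0; exact: (form_ge0 fD).
  have [t t0 [-> [Wt [Lt Dt]]]] := normalize _ Wv v_gt0.
  have : c <= t ^- 2 * D v v.
    by apply: ge_inf; [exact: infS.2|exists (t^-1 *: v)].
  by rewrite mulrC ler_pdivlMr ?exprn_gt0.
have c0 : 0 <= c by apply: lb_le_inf; [exact: infS.1|move=> x; exact: S_ge0].
pose M n := [set w | [/\ W w, L w w = 1 & D w w <= c + 16 ^- n]].
have r0 n : 0 < 16 ^- n :> R by rewrite invr_gt0 exprn_gt0.
have r_le := @geometric_le R.
have FM : Filter (filter_from setT M).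
  apply: filter_fromT_filter; first by exists 0%N.
  move=> i j; exists (maxn i j) => w [Ww Lw Dw].
  by split; split => //; apply: (le_trans Dw); rewrite lerD2l r_le //
    ?leq_maxl ?leq_maxr.
have PM : ProperFilter (filter_from setT M).
  apply: filter_from_proper => n _.
  have [_ [w [Ww Lw] <-] /ltW Dw] := inf_adherent (r0 n) infS.
  by exists w.
(* Refining the minimizing filter to an ultrafilter replaces the extraction of a subsequence: every
   bounded functional has small oscillation on some member of [F]. *)
have [F [FU MF]] := ultraFilterLemma PM.
have FMn n : F (M n) by apply: MF; exists n.
have small_L e : 0 < e -> exists2 A, F A &
    forall u v, A u -> A v -> L (u - v) (u - v) <= e.
  (* On [M 0] one has [D <= c + 1], hence [D (u - v) (u - v) <= 4 * (c + 1)] by the parallelogram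
     law, and [e'] times this is [e / 2]. *)
  move=> e0; pose e' := e / (8 * (c + 1)).
  have e'0 : 0 < e' by rewrite divr_gt0 // mulr_gt0 //; lra.
  have [I [l [l_lin l_bnd l_cpt]]] := XK e'0.
  (* The bound by 1 turns [|x| < eta] into [x ^+ 2 <= eta]; the other bound makes the sum over [I]
     at most [e / 2], also when [I] is empty. *)
  have eta0 : 0 < Num.min 1 (e / (2 * (#|I|%:R + 1))) :> R.
    have n0 := ler0n R #|I|; rewrite lt_min ltr01 divr_gt0 //; lra.
  set eta := Num.min _ _ in eta0.
  have /choice[A AP] i : exists A, F A /\
      forall u v, A u -> A v -> `|l i u - l i v| < eta.
    have [C CP] := l_bnd i.
    suff FC : F [set u | `|l i u| <= 1 + `|C|].
      by have [A ? ?] := ultra_small_oscillation FU eta0 FC; exists A.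
    apply: filterS (FMn 0%N) => u [Wu Lu _] /=.
    have := CP u (WX _ Wu); rewrite Lu mulr1 => h.
    have Cn := ler_norm C; have Cn0 := normr_ge0 C; have ln0 := normr_ge0 (l i u).
    rewrite leNgt; apply/negP => lt; move: h.
    rewrite -[X in X <= _]real_normK ?num_real //.
    by nra.
  exists (M 0%N `&` [set u | forall i, A i u]).
    apply: filterI; first exact: FMn.
    by apply: filter_forall => i; exact: (AP i).1.
  move=> u v [[Wu Lu Du] Au] [[Wv Lv Dv] Av].
  have Xu := WX _ Wu; have Xv := WX _ Wv.
  apply: (le_trans (l_cpt _ (subspaceB sX Xu Xv))).
  rewrite (form_parallelogram sX fD) //.
  have : 0 <= D (u + v) (u + v) by apply: (form_ge0 fD); exact: subspaceD.
  have : e' * (4 * (c + 1)) = e / 2 by rewrite /e'; field; rewrite lt0r_neq0 //; lra.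
  have : \sum_i l i (u - v) ^+ 2 <= e / 2.
    apply: (@le_trans _ _ (\sum_(i : I) eta)).
      apply: ler_sum => i _; have := (AP i).2 u v (Au i) (Av i).
      rewrite l_lin // -[X in X <= _]real_normK ?num_real //.
      have : eta <= 1 by rewrite ge_min lexx.
      by have := normr_ge0 (l i u - l i v); nra.
    rewrite sumr_const -mulr_natl -/(#|I|).
    have : eta <= e / (2 * (#|I|%:R + 1)) by rewrite ge_min lexx orbT.
    have : 0 <= #|I|%:R :> R by rewrite ler0n.
    set k : R := _%:R => k0; rewrite ler_pdivlMr; last by rewrite mulr_gt0 //; lra.
    by nra.
  move: Du Dv; rewrite expr0 invr1; nra.
have diam n : exists2 A, F A & forall u v, A u -> A v ->
    form_add D L (u - v) (u - v) <= 16 ^- n.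
  (* The inequality [cP] at [u + v] and the parallelogram law in both forms give [D (u - v) (u - v)
     <= 4 * 16 ^- n.+1 + c * L (u - v) (u - v)]. With this tolerance on [L], the sum of the two
     forms is at most three quarters of [16 ^- n]. *)
  have e0 : 0 < 16 ^- n / (2 * (c + 1)) by rewrite divr_gt0 // mulr_gt0 //; lra.
  have [A FA AP] := small_L _ e0.
  exists (M n.+1 `&` A); first by apply: filterI => //; exact: FMn.
  move=> u v [[Wu Lu Du] Au] [[Wv Lv Dv] Av]; rewrite /form_add.
  have Xu := WX _ Wu; have Xv := WX _ Wv.
  have := cP _ (subspaceD sW Wu Wv); have := AP _ _ Au Av.
  have := form_parallelogram sX fL Xu Xv.
  rewrite (form_parallelogram sX fD) // Lu Lv.
  have : 16 ^- n / (2 * (c + 1)) * (c + 1) = 16 ^- n / 2.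
    by field; rewrite !lt0r_neq0 ?exprn_gt0 //; lra.
  move: Du Dv; rewrite exprS invfM; have := r0 n.
  set e := _ / (2 * _); set r := 16 ^- n; set x := L _ _; set y := D _ _.
  by nra.
have /choice[A AP] n : exists A, F A /\ forall u v, A u -> A v ->
    form_add D L (u - v) (u - v) <= 16 ^- n.
  by have [A ? ?] := diam n; exists A.
(* Taking [u_ n] in all of [A 0], ..., [A n] puts [u_ n] and every later term in the same set
   [A n]. *)
have /choice[u_ u_P] n : exists u, M n u /\ forall i, (i <= n)%N -> A i u.
  have : F (M n `&` [set u | forall i : 'I_n.+1, A i u]).
    apply: filterI; first exact: FMn.
    by apply: filter_forall => i; exact: (AP i).1.
  move=> /filter_ex[u [Mu Au]]; exists u; split => // i ni.
  by have := Au (Ordinal (ni : (i < n.+1)%N)).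
have Wu_ n : W (u_ n) by have [[]] := u_P n.
have [|n m nm|u Xu uE] := XC (u_ := u_).
- by move=> n; exact: WX.
- by apply: (AP n).2; apply: (u_P _).2.
have Wu : W u by apply: eigenset_closed uE.
have uh n : X (u - u_ n) by apply: subspaceB => //; exact: WX.
exists c, u; split => //.
- apply/eqP; rewrite -subr_eq0 -sqrf_eq0 eq_le sqr_ge0 andbT.
  (* With [x = L h h] and [y = L h (u_ n)] for [h = u - u_ n], one has [(x + 2 * y) ^+ 2 <= 2 * x ^+
     2 + 8 * y ^+ 2], and both squares are at most [16 ^- n]. *)
  apply: (@le_geometric_le0 _ _ 10) => n.
  have Xn := WX _ (Wu_ n); have [Mn _] := u_P n; have [_ Ln _] := Mn.
  have -> : L u u - 1 = L (u - u_ n) (u - u_ n) + 2 * L (u - u_ n) (u_ n).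
    by have := form_sqD sX fL (uh n) Xn; rewrite subrK Ln => ->; ring.
  have := uE n; rewrite /form_add; have := form_CS sX fL (uh n) Xn.
  have := form_ge0 fD (uh n); have := form_ge0 fL (uh n); rewrite Ln mulr1.
  set x := L _ _; set y := L _ _; set z := D _ _.
  have := r0 n; have := r_le 0%N n (leq0n n); rewrite expr0 invr1.
  set r := 16 ^- n => *.
  have : x ^+ 2 <= r by nra.
  by have : 0 <= (x - 2 * y) ^+ 2 := sqr_ge0 _; lra.
- move=> v Wv; have Xv := WX _ Wv.
  (* By minimality [B] is positive semidefinite on [W], and [B (u_ n) (u_ n)] tends to 0;
     Cauchy-Schwarz for [B] then makes [B u] vanish on [W], which is the Euler-Lagrange equation. *)
  pose B u v := D u v - c * L u v.
  have fB : psd_form W B.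
    split=> [a x y z /WX Xx /WX Xy /WX Xz|x y /WX Xx /WX Xy|x Wx]; rewrite /B.
    - by rewrite (form_lin fD) // (form_lin fL) //; ring.
    - by rewrite (form_sym fD) // (form_sym fL).
    - by rewrite subr_ge0; exact: cP.
  apply/eqP; rewrite -subr_eq0 -/(B u v) -sqrf_eq0 eq_le sqr_ge0 andbT.
  apply: (@le_geometric_le0 _ _ (4 * B v v)) => n.
  have [[Wn Ln Dn] _] := u_P n.
  have Wh : W (u - u_ n) by exact: (subspaceB sW).
  have -> : B u v = B (u - u_ n) v + B (u_ n) v.
    by rewrite -(formDl fB) // subrK.
  have := form_CS sW fB Wh Wv; have := form_CS sW fB Wn Wv.
  have Bn : B (u_ n) (u_ n) <= 16 ^- n by rewrite /B Ln; lra.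
  have Bh : B (u - u_ n) (u - u_ n) <= 16 ^- n.
    apply: le_trans (uE n); rewrite /B /form_add.
    by have := form_ge0 fL (uh n); nra.
  have : B (u_ n) (u_ n) * B v v <= 16 ^- n * B v v.
    by apply: ler_wpM2r => //; exact: (form_ge0 fB).
  have : B (u - u_ n) (u - u_ n) * B v v <= 16 ^- n * B v v.
    by apply: ler_wpM2r => //; exact: (form_ge0 fB).
  set p := B (u - _) v; set q := B (u_ n) v => *.
  have : 0 <= (p - q) ^+ 2 by exact: sqr_ge0.
  by lra.
Qed.

End rayleigh.

(** * Sums of eigenspaces and the saddle argument *)

Section spectral.
Context {R : realType} {V : lmodType R}.
Implicit Types (u v w e z : V).
Variables (X : set V) (D L : V -> V -> R) (lam : nat -> R).

Definition eigsum j : set V := [set u |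
  exists2 e : nat -> V,
    (forall i, (0 < i <= j)%N -> eigenset X D L X (lam i) (e i)) &
    u = \sum_(1 <= i < j.+1) e i].

Definition eigsum_orth j : set V := [set w |
  X w /\ forall v, eigsum j v -> D w v = 0].

Hypotheses (sX : subspace X) (fD : psd_form X D) (fL : psd_form X L).
Hypotheses (XC : complete_form X (form_add D L)) (XK : compact_form X D L).
Hypothesis lam1_gt0 : 0 < lam 1%N.
Hypothesis lam_lt : forall j, (0 < j)%N -> lam j < lam j.+1.
Hypothesis lam_all : forall c, (exists2 u, eigenset X D L X c u & 0 < L u u) ->
  exists2 j, (0 < j)%N & lam j = c.

Local Notation E j := (eigenset X D L X (lam j)).
Local Notation N := eigsum.
Local Notation M := eigsum_orth.

Let EX j u : E j u -> X u. Proof. by case. Qed.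

Let sE j : subspace (E j). Proof. exact: eigenset_subspace. Qed.

Lemma eigenvalue_homo i j : (0 < i)%N -> (i < j)%N -> lam i < lam j.
Proof.
move=> i0; elim: j => // j IH; rewrite ltnS leq_eqVlt => /predU1P[<-|ij].
  exact: lam_lt.
by apply: (lt_trans (IH ij)); apply: lam_lt; exact: leq_ltn_trans ij.
Qed.

Lemma eigenvalue_le i j : (0 < i)%N -> (i <= j)%N -> lam i <= lam j.
Proof.
move=> i0; rewrite leq_eqVlt => /predU1P[->//|ij].
by apply: ltW; exact: eigenvalue_homo.
Qed.

Lemma eigenvalue_gt0 j : (0 < j)%N -> 0 < lam j.
Proof. by move=> j0; apply: (lt_le_trans lam1_gt0); exact: eigenvalue_le. Qed.

(** Computing [D u v] from either eigenvalue equation gives [(lam i - lam j) * L u v = 0]. *)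
Lemma eigen_orth i j u v : (0 < i)%N -> (0 < j)%N -> i != j -> E i u -> E j v ->
  L u v = 0 /\ D u v = 0.
Proof.
move=> i0 j0 ij [Xu uE] [Xv vE].
have Lij : (lam i - lam j) * L u v = 0.
  rewrite mulrBl -(uE v Xv) (form_sym fL) // -(vE u Xu) (form_sym fD) //.
  by rewrite subrr.
have L0 : L u v = 0.
  move/eqP: Lij; rewrite mulf_eq0 subr_eq0 => /orP[/eqP lij|/eqP//].
  have [lt_ij|lt_ji|/eqP] := ltngtP i j; last by rewrite (negPf ij).
  - by have := eigenvalue_homo i0 lt_ij; rewrite lij ltxx.
  - by have := eigenvalue_homo j0 lt_ji; rewrite lij ltxx.
by rewrite uE // L0 mulr0.
Qed.

(** The projection is taken for [D + L], for which completeness is known. For [f] in the eigenspace,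
    orthogonality then reads [(lam j + 1) * L (u - e) f = 0], which yields it for each form. *)
Lemma eigen_projection j u : (0 < j)%N -> X u ->
  exists2 e, E j e & forall f, E j f -> D (u - e) f = 0 /\ L (u - e) f = 0.
Proof.
move=> j0 Xu; have l0 := eigenvalue_gt0 j0.
have EjX : E j `<=` X by move=> ? [].
have cE : closed_for X (form_add D L) (E j) by exact: eigenset_closed.
have [e Ee eP] := closed_projection sX (psd_form_add fD fL) XC (sE j) EjX cE Xu.
exists e => // f Ef; have Xf := EX Ef.
have Xue : X (u - e) by apply: (subspaceB sX) => //; exact: EX Ee.
have := eP f Ef; rewrite /form_add (form_sym fD) // Ef.2 // (form_sym fL) //.
set x := L _ _ => h.
have : (lam j + 1) * x = 0 by rewrite -h; ring.
move=> /eqP; rewrite mulf_eq0 => /orP[/eqP|/eqP x0]; first by lra.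
by rewrite x0 mulr0.
Qed.

Lemma eigsumX j v : N j v -> X v.
Proof.
move=> [e Ee ->]; rewrite big_nat_cond; apply: (subspace_sum sX) => i.
by rewrite andbT => ij; have [] := Ee i ij.
Qed.

Lemma eigsum_subspace j : subspace (N j).
Proof.
split=> [|c u v [e Ee ->] [f Ef ->]].
  by exists (fun=> 0) => [i _|]; [exact: subspace0 (sE i)|rewrite big1].
exists (fun i => c *: e i + f i) => [i ij|].
  by apply: (sE i).2; [exact: Ee|exact: Ef].
by rewrite scaler_sumr -big_split.
Qed.

Lemma eigsum_orthE j : M j = eigenset X D L (N j) 0.
Proof.
apply/seteqP; split => w [Xw wN]; split => // v Nv.
  by rewrite mul0r; exact: wN.
by rewrite wN // mul0r.
Qed.

Lemma eigsum_orth_subspace j : subspace (M j).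
Proof. by rewrite eigsum_orthE; apply: eigenset_subspace => // v; exact: eigsumX. Qed.

Lemma eigen_eigsum i j u : (0 < i <= j)%N -> E i u -> N j u.
Proof.
move=> ij Eu; exists (fun m => if m == i then u else 0) => [m mj|].
  by case: eqP => [->//|_]; exact: subspace0 (sE m).
rewrite (bigD1_seq i) /= ?mem_index_iota ?iota_uniq //.
by rewrite eqxx big1 ?addr0 // => m /negPf ->.
Qed.

Lemma eigsumS j v : N j.+1 v -> exists v' e, [/\ N j v', E j.+1 e & v = v' + e].
Proof.
move=> [e Ee ->]; rewrite big_nat_recr //=.
exists (\sum_(1 <= i < j.+1) e i), (e j.+1); split=> //.
  by exists e => // i /andP[i0 ij]; apply: Ee; rewrite i0 leqW.
by apply: Ee; rewrite leqnn.
Qed.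

Lemma eigsum_eigen_orth j i v e : (j < i)%N -> N j v -> E i e ->
  D e v = 0 /\ L e v = 0.
Proof.
move=> ji [f Ef ->] Ee; have Xe := EX Ee.
have Xf m : (1 <= m < j.+1)%N && true -> X (f m).
  by rewrite andbT => mj; have [] := Ef m mj.
have Xs : X (\sum_(1 <= m < j.+1) f m).
  by rewrite big_nat_cond; exact: (subspace_sum sX).
rewrite (form_sym fD) // (form_sym fL) // big_nat_cond.
rewrite (form_sum sX fD) // (form_sum sX fL) //.
suff Z m : (1 <= m < j.+1)%N && true -> L (f m) e = 0 /\ D (f m) e = 0.
  by rewrite !big1 // => m /Z[].
rewrite andbT => mj; have [m0 mj'] := andP mj.
apply: (@eigen_orth m i) => //; [|by rewrite ltn_eqF // (leq_ltn_trans _ ji)|].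
- exact: leq_ltn_trans ji.
- exact: Ef.
Qed.

Lemma eigsum_add j v e : N j v -> E j.+1 e -> N j.+1 (v + e).
Proof.
move=> [f Ef ->] Ee; exists (fun i => if i == j.+1 then e else f i).
  move=> i /andP[i0]; rewrite leq_eqVlt => /predU1P[->|ij]; first by rewrite eqxx.
  by rewrite ltn_eqF //; apply: Ef; rewrite i0.
rewrite [RHS]big_nat_recr //= eqxx; congr (_ + _).
by apply: eq_big_nat => i /andP[_ ij]; rewrite ltn_eqF.
Qed.

(** Subtracting the projection on the next eigenspace keeps orthogonality to the previous ones,
    since that projection is itself orthogonal to them. *)
Lemma eigsum_orth_split j z : M j z ->
  exists e w, [/\ E j.+1 e, M j.+1 w & z = e + w].
Proof.
move=> Mz; have Xz := Mz.1; have [e Ee eP] := eigen_projection (ltn0Sn j) Xz.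
have Xe := EX Ee.
exists e, (z - e); split => //; last by rewrite addrC subrK.
split=> [|_ /eigsumS[v [f [Nv Ef ->]]]]; first exact: (subspaceB sX).
have Xv := eigsumX Nv; have Xf := EX Ef.
rewrite (formDr sX fD) //; last exact: (subspaceB sX).
rewrite (eP _ Ef).1 (formBl sX fD) // Mz.2 //.
by rewrite (eigsum_eigen_orth (ltnSn j) Nv Ee).1 subrr addr0.
Qed.

(** Eigenspaces are split off one at a time, starting from the zero space and its complement [X]. *)
Lemma eigsum_decomposition j u : X u ->
  exists v w, [/\ N j v, M j w & u = v + w].
Proof.
move=> Xu; elim: j => [|j [v [z [Nv Mz ->]]]].
  exists 0, u; split; [exact: subspace0 (eigsum_subspace 0)| |by rewrite add0r].
  split=> // _ [e _ ->]; rewrite big_geq // (form_sym fD) //; last exact: sX.1.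
  exact: (form0l sX fD).
have [e [w [Ee Mw ->]]] := eigsum_orth_split Mz.
by exists (v + e), w; split; [exact: eigsum_add| |rewrite addrA].
Qed.

(** On each eigenspace [D] is [lam i * L] with [lam i > 0], so [D]-orthogonality to it is also
    [L]-orthogonality. *)
Lemma eigsum_orth_L j u v : M j u -> N j v -> L u v = 0.
Proof.
move=> Mu [e Ee ->]; have Xu := Mu.1.
have Xe m : (1 <= m < j.+1)%N && true -> X (e m).
  by rewrite andbT => mj; have [] := Ee m mj.
rewrite (form_sym fL) //; last by rewrite big_nat_cond; exact: (subspace_sum sX).
rewrite big_nat_cond (form_sum sX fL) // big1 // => i ij; have Xei := Xe _ ij.
move: ij; rewrite andbT => ij; have l0 := eigenvalue_gt0 (proj1 (andP ij)).
have := Mu.2 _ (eigen_eigsum ij (Ee i ij)).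
rewrite (form_sym fD) // (Ee i ij).2 // => /eqP.
by rewrite mulf_eq0 gt_eqF //= => /eqP.
Qed.

(** The components of [v] are mutually orthogonal, so both sides are sums of [L (e i) (e i)], with
    weights [lam i] on the left and [lam j] on the right. *)
Lemma eigsum_bound j v : (0 < j)%N -> N j v -> D v v <= lam j * L v v.
Proof.
move=> j0 Nv; have Xv := eigsumX Nv; case: (Nv) => e Ee vE.
have Xe m : (1 <= m < j.+1)%N && true -> X (e m).
  by rewrite andbT => mj; have [] := Ee m mj.
rewrite {1 3}vE big_nat_cond (form_sum sX fD) // (form_sum sX fL) // mulr_sumr.
apply: ler_sum => i; rewrite andbT => ij; have [i0 ij'] := andP ij.
rewrite (Ee i ij).2 //; apply: ler_wpM2r; last exact: eigenvalue_le.
have Xei : X (e i) by apply: Xe; rewrite ij.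
suff -> : L (e i) v = L (e i) (e i) by exact: (form_ge0 fL).
rewrite (form_sym fL) // vE big_nat_cond (form_sum sX fL) // -big_nat_cond.
rewrite (bigD1_seq i) /= ?mem_index_iota ?iota_uniq //.
rewrite big_nat_cond big1 ?addr0 // => m /andP[mj mi].
have [m0 _] := andP mj.
by have [L0 _] := eigen_orth m0 i0 mi (Ee m mj) (Ee i ij).
Qed.

(** A minimizer [u] of the Rayleigh quotient on the complement is an eigenvector in [X], so the
    minimum is some [lam i]. If [i <= j], then [u] would lie in [eigsum j] and be orthogonal to
    itself, against [L u u = 1]. *)
Lemma eigsum_orth_bound j w : M j w -> lam j.+1 * L w w <= D w w.
Proof.
move=> Mw; have Xw := Mw.1; have := form_ge0 fL Xw.
rewrite le_eqVlt => /predU1P[<-|w_gt0].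
  by rewrite mulr0; exact: (form_ge0 fD).
have NX : N j `<=` X by move=> ?; exact: eigsumX.
have [|c [u]] := rayleigh_min sX fD fL XC XK NX.
  by exists w => //; rewrite -eigsum_orthE.
rewrite -!eigsum_orthE => -[Mu Lu uP cP]; have Xu := Mu.1.
(* The equation is known only for test functions in the complement. On [eigsum j] both sides vanish,
   and the decomposition of [X] extends it to all test functions. *)
have Eu : eigenset X D L X c u.
  split=> // v Xv; have [v' [x [Nv' Mx ->]]] := eigsum_decomposition j Xv.
  have Xv' := eigsumX Nv'; have Xx := Mx.1.
  rewrite (formDr sX fD) // (formDr sX fL) // Mu.2 // (eigsum_orth_L Mu Nv').
  by rewrite uP // !add0r.
have [|i i0 lc] := lam_all (c := c).
  by exists u => //; rewrite Lu.
have [ji|ij] := ltnP j i.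
  apply: (le_trans _ (cP _ Mw)); rewrite -lc ler_wpM2r ?(ltW w_gt0) //.
  exact: eigenvalue_le.
have Nu : N j u by apply: (@eigen_eigsum i); rewrite ?i0 // lc.
by have := eigsum_orth_L Mu Nu; rewrite Lu => /eqP; rewrite oner_eq0.
Qed.

(** * Critical points of a functional with bounded second-order remainder *)

Section no_critical_point.
Variables (J : V -> R) (lo hi : R) (j : nat) (u z p phi : V).
Hypotheses (j_gt0 : (0 < j)%N) (lo_gt : lam j < lo) (hi_lt : hi < lam j.+2).
Hypothesis J_homo : forall c x, 0 < c -> X x -> J (c *: x) = c ^+ 2 * J x.
(** [J] stands for $I(\cdot,a,b)$, and [lo], [hi] for the minimum and maximum of $a$ and $b$. Both 0
    and [u] are critical points at level 0; [J0] and [Ju] are the second-order expansions there. *)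
Hypothesis J0 : forall h, X h ->
  D h h - hi * L h h <= 2 * J h <= D h h - lo * L h h.
Hypothesis Ju : forall h, X h ->
  D h h - hi * L h h <= 2 * J (u + h) <= D h h - lo * L h h.
Hypothesis Ephi : E j.+1 phi.
Hypothesis simple : forall e, E j.+1 e -> exists c : R,
  L (e - c *: phi) (e - c *: phi) = 0.
Hypotheses (Xu : X u) (u_neq0 : L u u != 0).
Hypotheses (Mz : M j z) (Jz : forall v, N j v -> J (v + z) < 0).
Hypotheses (Np : N j.+1 p) (Jp : forall w, M j.+1 w -> 0 < J (p + w)).

Let Xphi := EX Ephi.

(** Simplicity gives [phi] as a spanning vector only up to [L]-null vectors. Such a remainder is
    null for both forms, so it can be absorbed in either summand of a decomposition. *)
Let null_orth e : E j.+1 e -> L e e = 0 -> M j.+1 e /\ E j e.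
Proof.
move=> Ee e0; have Xe := EX Ee.
have Le v : X v -> L e v = 0 by move=> Xv; exact: (form_eq0 sX fL).
have De v : X v -> D e v = 0 by move=> Xv; rewrite Ee.2 // Le // mulr0.
split; split=> // v; first by move=> /eigsumX; exact: De.
by move=> Xv; rewrite De // Le // mulr0.
Qed.

Let simple_split e : E j.+1 e -> exists c r,
  [/\ M j.+1 r, N j r & e = c *: phi + r].
Proof.
move=> Ee; have [c c0] := simple Ee; exists c, (e - c *: phi).
have Er : E j.+1 (e - c *: phi).
  by apply: (subspaceB (sE _)) => //; exact: (subspaceZ (sE _)).
have [Mr Er'] := null_orth Er c0; split => //.
  by apply: eigen_eigsum Er'; rewrite j_gt0 /=.
by rewrite addrC subrK.
Qed.

(** Scaling by [b / a] carries a point with coordinate [a] along [phi] to one with coordinate [b];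
    this compares two points whose coordinates have the same sign. *)
Let split_homo a b v w : 0 < b / a -> N j v -> M j.+1 w ->
  J (v + b *: phi + (b / a) *: w) =
  (b / a) ^+ 2 * J ((b / a)^-1 *: v + a *: phi + w).
Proof.
move=> t0 Nv [Xw _]; have Xv := eigsumX Nv.
have a0 : a != 0 by apply: contraTneq t0 => ->; rewrite invr0 mulr0 ltxx.
rewrite -J_homo //; last first.
  apply: (subspaceD sX) => //; apply: (subspaceD sX); exact: (subspaceZ sX).
by rewrite !scalerDr !scalerA mulfV ?gt_eqF // scale1r divfK.
Qed.

Let gap_N v : N j v -> 0 <= (lo - lam j) * L v v.
Proof.
move=> Nv; apply: mulr_ge0; first by rewrite subr_ge0 ltW.
exact: (form_ge0 fL (eigsumX Nv)).
Qed.

Let gap_M w : M j.+1 w -> 0 <= (lam j.+2 - hi) * L w w.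
Proof.
move=> Mw; apply: mulr_ge0; first by rewrite subr_ge0 ltW.
exact: (form_ge0 fL Mw.1).
Qed.

Let J_N v : N j v -> 2 * J v <= - (lo - lam j) * L v v.
Proof.
move=> Nv; have /andP[_ h] := J0 (eigsumX Nv); apply: (le_trans h).
by have := eigsum_bound j_gt0 Nv; lra.
Qed.

Let J_M w : M j.+1 w -> (lam j.+2 - hi) * L w w <= 2 * J w.
Proof.
move=> Mw; have /andP[h _] := J0 Mw.1; apply: le_trans h.
by have := eigsum_orth_bound Mw; lra.
Qed.

(* The components along phi of z, p and the critical point u would have to be
   of pairwise opposite signs. *)
Lemma saddle_no_critical_point : False.
Proof.
have sN := eigsum_subspace j; have sM := eigsum_orth_subspace j.+1.
(* The three points are written [u = v + c *: phi + w], [z = c1 *: phi + w1] and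
   [p = v2 + c2 *: phi], with null remainders put in the complement for [u] and [z], and in
   [eigsum j] for [p]. *)
have [n [w0 [Nn Mw0 uE]]] := eigsum_decomposition j.+1 Xu.
have [v [y [Nv Ey nE]]] := eigsumS Nn.
have [c [r [Mr _ yE]]] := simple_split Ey.
have {n w0 Nn Mw0 uE nE r Mr y Ey yE} [w Mw uE] :
    exists2 w, M j.+1 w & u = v + c *: phi + w.
  by exists (r + w0); [exact: (subspaceD sM)|rewrite uE nE yE !addrA].
have [y [w0 [Ey Mw0 zE]]] := eigsum_orth_split Mz.
have [c1 [r [Mr _ yE]]] := simple_split Ey.
have {w0 Mw0 zE r Mr y Ey yE} [w1 Mw1 zE] :
    exists2 w1, M j.+1 w1 & z = c1 *: phi + w1.
  by exists (r + w0); [exact: (subspaceD sM)|rewrite zE yE addrA].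
have [v0 [y [Nv0 Ey pE]]] := eigsumS Np.
have [c2 [r [_ Nr yE]]] := simple_split Ey.
have {v0 Nv0 pE r Nr y Ey yE} [v2 Nv2 pE] :
    exists2 v2, N j v2 & p = v2 + c2 *: phi.
  by exists (v0 + r); [exact: (subspaceD sN)|rewrite pE yE addrA addrAC].
have Xv := eigsumX Nv; have Xw := Mw.1.
(* From the critical point at level 0, a move along [eigsum j] cannot raise [J], as [lam j < lo]; a
   move along the complement cannot lower it, as [hi < lam j.+2]. *)
have Ju_N v' : N j v' -> J (v' + c *: phi + w) <= 0.
  move=> Nv'; have Nh : N j (v' - v) by exact: (subspaceB sN).
  have /andP[_] := Ju (eigsumX Nh).
  rewrite (_ : u + _ = v' + c *: phi + w); last first.
    by rewrite uE addrC !addrA subrK.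
  by have := eigsum_bound j_gt0 Nh; have := gap_N Nh; lra.
have Ju_M w' : M j.+1 w' -> 0 <= J (v + c *: phi + w').
  move=> Mw'; have Mh : M j.+1 (w' - w) by exact: (subspaceB sM).
  have /andP[+ _] := Ju Mh.1.
  rewrite (_ : u + _ = v + c *: phi + w'); last first.
    by rewrite uE -addrA [w + _]addrC subrK.
  by have := eigsum_orth_bound Mh; have := gap_M Mh; lra.
have NZ t v' : N j v' -> N j (t *: v') by exact: (subspaceZ sN).
have MZ t w' : M j.+1 w' -> M j.+1 (t *: w') by exact: (subspaceZ sM).
have Jz' v' : N j v' -> J (v' + c1 *: phi + w1) < 0.
  by move=> Nv'; rewrite -addrA -zE; exact: Jz.
have Jp' w' : M j.+1 w' -> 0 < J (v2 + c2 *: phi + w') by rewrite -pE; exact: Jp.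
(* With a zero coordinate, [z] would lie in [eigsum_orth j.+1], where [J] is nonnegative, and [p] in
   [eigsum j], where [J] is not positive. *)
have c1_neq0 : c1 != 0.
  apply/eqP => c10; have := Jz' 0 sN.1; rewrite c10 scale0r !add0r.
  by have := J_M Mw1; have := gap_M Mw1; lra.
have c2_neq0 : c2 != 0.
  apply/eqP => c20; have := Jp' 0 sM.1; rewrite c20 scale0r !addr0.
  by have := J_N Nv2; have := gap_N Nv2; lra.
(* With a zero coordinate, [J w <= 0] and [0 <= J v] would force [v] and [w] to be [L]-null, and
   hence [u] as well. *)
have c_neq0 : c != 0.
  apply: contra_neq u_neq0 => c0.
  have Lw : L w w = 0.
    have Jw := Ju_N 0 sN.1; rewrite c0 scale0r !add0r in Jw.
    have : (lam j.+2 - hi) * L w w = 0.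
      by have := J_M Mw; have := gap_M Mw; lra.
    by move=> /eqP; rewrite mulf_eq0 subr_eq0 gt_eqF //= => /eqP.
  have Lv : L v v = 0.
    have Jv := Ju_M 0 sM.1; rewrite c0 scale0r !addr0 in Jv.
    have : (lo - lam j) * L v v = 0.
      by have := J_N Nv; have := gap_N Nv; lra.
    by move=> /eqP; rewrite mulf_eq0 subr_eq0 gt_eqF //= => /eqP.
  rewrite uE c0 scale0r addr0 (form_sqD sX fL) // Lw Lv.
  by rewrite (form_eq0 sX fL) //; ring.
have opp_sign (a b : R) : a != 0 -> b != 0 -> (0 < b / a -> False) -> a * b < 0.
  move=> a0 b0 h; have ab0 := mulf_neq0 a0 b0.
  have [//|ab|abE] := ltgtP (a * b) 0; last by rewrite abE eqxx in ab0.
  case: h.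
  have -> : b / a = a * b * (a^-1) ^+ 2 by field.
  by rewrite pmulr_rgt0 // exprn_even_gt0 //= invr_eq0.
(* If [c / c1] were positive, [J] at [v + c *: phi + (c / c1) *: w1] would be nonnegative because of
   [u], and negative because of [z] after rescaling. The other two pairs are treated in the same
   way. *)
have c1c : c1 * c < 0.
  apply: opp_sign => // t0; have := split_homo t0 Nv Mw1.
  have := Ju_M _ (MZ (c / c1) _ Mw1); have := Jz' _ (NZ (c / c1)^-1 _ Nv).
  move=> neg pos eqJ; move: pos; rewrite eqJ pmulr_rge0 ?exprn_gt0 //.
  by rewrite leNgt neg.
have cc2 : c * c2 < 0.
  apply: opp_sign => // t0; have := split_homo t0 Nv2 Mw.
  have := Jp' _ (MZ (c2 / c) _ Mw); have := Ju_N _ (NZ (c2 / c)^-1 _ Nv2).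
  move=> neg pos eqJ; move: pos; rewrite eqJ pmulr_rgt0 ?exprn_gt0 //.
  by rewrite ltNge neg.
have c1c2 : c1 * c2 < 0.
  apply: opp_sign => // t0; have := split_homo t0 Nv2 Mw1.
  have := Jp' _ (MZ (c2 / c1) _ Mw1); have := Jz' _ (NZ (c2 / c1)^-1 _ Nv2).
  move=> neg pos eqJ; move: pos; rewrite eqJ pmulr_rgt0 ?exprn_gt0 //.
  by rewrite ltNge (ltW neg).
have : 0 < (c1 * c) * (c * c2) by rewrite nmulr_rgt0.
by have : 0 <= c ^+ 2 := sqr_ge0 c; nra.
Qed.

End no_critical_point.
End spectral.

(** * Square integrable functions *)

Section square_integrable.
Context d (T : measurableType d) (R : realType).
Variables (mu : {measure set T -> \bar R}) (D : set T).
Hypothesis mD : measurable D.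
Implicit Types f g h : T -> R.

Definition sqint : set (T -> R) := [set f : T -> R |
  measurable_fun D f /\ (\int[mu]_(x in D) (f x ^+ 2)%:E < +oo)%E].

Definition L2prod f g : R := \int[mu]_(x in D) (f x * g x).

Lemma sqint_integrable f : sqint f -> mu.-integrable D (fun x => (f x ^+ 2)%:E).
Proof.
move=> [mf f2]; apply/integrableP; split.
  by apply/measurable_EFinP; exact: measurable_funX.
apply: le_lt_trans f2; rewrite le_eqVlt; apply/orP; left; apply/eqP.
by apply: eq_integral => x _; rewrite gee0_abs // lee_fin sqr_ge0.
Qed.

Lemma integrable_sqint f : measurable_fun D f ->
  mu.-integrable D (fun x => (f x ^+ 2)%:E) -> sqint f.
Proof.
move=> mf /integrableP[_ f2]; split=> //; apply: le_lt_trans f2.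
rewrite le_eqVlt; apply/orP; left; apply/eqP.
by apply: eq_integral => x _; rewrite gee0_abs // lee_fin sqr_ge0.
Qed.

(** The product is dominated by the sum of the squares. *)
Lemma sqint_mul f g : sqint f -> sqint g ->
  mu.-integrable D (fun x => (f x * g x)%:E).
Proof.
move=> f2 g2; have fg2 := integrableD mD (sqint_integrable f2) (sqint_integrable g2).
apply: (le_integrable mD _ _ fg2).
  by apply/measurable_EFinP; apply: measurable_funM; [exact: f2.1|exact: g2.1].
move=> x _; rewrite -EFinD !abse_EFin lee_fin normrM.
rewrite [leRHS]ger0_norm ?addr_ge0 ?sqr_ge0 // -(real_normK (num_real (f x))).
rewrite -(real_normK (num_real (g x))).
have := normr_ge0 (f x); have := normr_ge0 (g x).
by have := sqr_ge0 (`|f x| - `|g x|); nra.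
Qed.

Lemma sqint_lin c f g : sqint f -> sqint g -> sqint (fun x => c * f x + g x).
Proof.
move=> f2 g2; apply: integrable_sqint.
  by apply: measurable_funD; [apply: measurable_funM => //; exact: f2.1|exact: g2.1].
have := integrableD mD (integrableD mD
  (integrableZl mD (c ^+ 2) (sqint_integrable f2))
  (integrableZl mD (2 * c) (sqint_mul f2 g2))) (sqint_integrable g2).
apply: eq_integrable => // x _ /=; rewrite -!EFinM -!EFinD; congr (_%:E).
ring.
Qed.

Lemma sqint_subspace : subspace (sqint : set ((T -> R^o) : lmodType R)).
Proof.
split; last exact: sqint_lin.
split; first exact: measurable_cst.
under eq_integral => x _ do rewrite expr0n /=.
by rewrite integral0.
Qed.

Lemma L2prod_form :
  psd_form (sqint : set ((T -> R^o) : lmodType R)) L2prod.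
Proof.
split=> [c f g h f2 g2 h2|f g _ _|f _].
- rewrite /L2prod -RintegralZl //; last exact: sqint_mul.
  rewrite -RintegralD //; last 2 first.
  - rewrite (_ : EFin \o _ = (fun x => c%:E * (f x * h x)%:E)%E) //.
    by apply: integrableZl => //; exact: sqint_mul.
  - exact: sqint_mul.
  apply: eq_Rintegral => x _.
  by rewrite -[LHS]/((c * f x + g x) * h x); ring.
- by apply: eq_Rintegral => x _; exact: mulrC.
- by apply: Rintegral_ge0 => x _; exact: sqr_ge0.
Qed.

Lemma L2prod_EFin f : sqint f ->
  (\int[mu]_(x in D) (f x ^+ 2)%:E)%E = (L2prod f f)%:E.
Proof.
move=> f2; rewrite /L2prod /Rintegral fineK //.
by apply: integrable_fin_num => //; exact: sqint_integrable.
Qed.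

(** The square of the limit agrees almost everywhere with the lower limit of the squares, to which
    Fatou's lemma applies. *)
Lemma fatou_sqint (f_ : nat -> T -> R) f (c : R) :
  (forall n, measurable_fun D (f_ n)) -> measurable_fun D f ->
  {ae mu, forall x, D x -> f_ n x @[n --> \oo] --> f x} ->
  (forall n, (\int[mu]_(x in D) (f_ n x ^+ 2)%:E <= c%:E)%E) ->
  (\int[mu]_(x in D) (f x ^+ 2)%:E <= c%:E)%E.
Proof.
move=> mf_ mf f_f f_c.
pose g n x := (f_ n x ^+ 2)%:E.
have mg n : measurable_fun D (g n).
  by apply/measurable_EFinP; exact: measurable_funX.
have g0 n x : D x -> (0 <= g n x)%E by rewrite lee_fin sqr_ge0.
have -> : (\int[mu]_(x in D) (f x ^+ 2)%:E =
    \int[mu]_(x in D) limn_einf (g^~ x))%E.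
  apply: ge0_ae_eq_integral => //.
  - by apply/measurable_EFinP; exact: measurable_funX.
  - rewrite (_ : (fun x => _) =
      (fun x => - limn_esup ((fun n x => - g n x) ^~ x))%E); last first.
      by apply/funext => x; rewrite limn_esupN oppeK.
    apply: measurableT_comp => //.
    apply: measurable_fun_limn_esup => n.
    exact: measurableT_comp.
  - by move=> x _; rewrite lee_fin sqr_ge0.
  - move=> x Dx; rewrite limn_einf_lim; apply: lime_ge; first exact: is_cvg_einfs.
    by apply: nearW => n; apply: le_ereal_inf_tmp => _ [m _ <-]; exact: g0.
  - apply: filterS f_f => x xP Dx; apply/esym.
    have gx : g n x @[n --> \oo] --> (f x ^+ 2)%:E.
      by apply: cvg_EFin; [exact: nearW|rewrite /g /= expr2; apply: cvgM; exact: xP].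
    by rewrite (cvg_limn_einf_sup gx).1.
apply: (le_trans (fatou mu mD mg g0)).
rewrite limn_einf_lim; apply: lime_le; first exact: is_cvg_einfs.
apply: nearW => n; apply: (le_trans _ (f_c n)).
by apply: ereal_inf_lbound; exists n => //=.
Qed.

(** The sum of [4 ^+ n * (f_ n.+1 - f_ n) ^+ 2] has a finite integral, hence is finite almost
    everywhere. Where it equals [C], the increments are at most [(1 + C) * 2 ^- n] and the
    telescoping series converges. *)
Lemma fast_cauchy_ae_cvg (f_ : nat -> T -> R) :
  (forall n, measurable_fun D (f_ n)) ->
  (forall n, (\int[mu]_(x in D) ((f_ n.+1 x - f_ n x) ^+ 2)%:E
     <= (16 ^- n)%:E)%E) ->
  {ae mu, forall x, D x -> cvgn (f_ ^~ x)}.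
Proof.
move=> mf hf.
pose g n x := (4 ^+ n * (f_ n.+1 x - f_ n x) ^+ 2)%:E.
have mg n : measurable_fun D (g n).
  apply/measurable_EFinP; apply: measurable_funM => //.
  by apply: measurable_funX; exact: measurable_funB.
have g0 n x : D x -> (0 <= g n x)%E.
  by move=> _; rewrite /g lee_fin mulr_ge0 ?sqr_ge0 ?exprn_ge0.
have ig : (\int[mu]_(x in D) (\sum_(0 <= n <oo) g n x) < +oo)%E.
  rewrite integral_nneseries //.
  (* The terms integrate to at most [4 ^+ n * 16 ^- n = 4 ^- n], which is bounded by [2 ^- n], of
     sum 2. *)
  apply: (@le_lt_trans _ _ 2%:E); last exact: ltry.
  have := @epsilon_trick0 R 2 xpredT (ltW (ltr0Sn _ _)).
  apply: le_trans; apply: lee_nneseries => [i _ _|n _].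
    by apply: integral_ge0 => x; exact: g0.
  rewrite /g; under eq_integral do rewrite EFinM.
  rewrite ge0_integralZl_EFin //; last first.
  - apply/measurable_EFinP.
    by apply: measurable_funX; exact: measurable_funB.
  - by move=> x _; rewrite lee_fin sqr_ge0.
  apply: (@le_trans _ _ ((4 ^+ n)%:E * (16 ^- n)%:E)%E).
    by rewrite lee_wpmul2l // lee_fin exprn_ge0.
  rewrite -EFinM lee_fin natrX exprS invfM mulrA mulfV ?pnatr_eq0 // mul1r.
  have -> : 16 = 4 * 4 :> R by ring.
  rewrite exprMn invfM mulrA mulfV ?expf_neq0 // mul1r.
  rewrite lef_pV2 ?posrE ?exprn_gt0 //.
  by apply: lerXn2r; rewrite ?nnegrE //; lra.
have Ig : mu.-integrable D (fun x => \sum_(0 <= n <oo) g n x)%E.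
  apply/integrableP; split.
    by apply: ge0_emeasurable_sum => // n x Dx _; exact: g0.
  apply: le_lt_trans ig; rewrite le_eqVlt; apply/orP; left; apply/eqP.
  apply: eq_integral => x /[!inE] Dx; rewrite gee0_abs //.
  by apply: nneseries_ge0 => n _ _; exact: g0.
apply: filterS (integrable_ae mD Ig) => x fin_x Dx.
have {}fin_x := fin_x Dx.
pose C := fine (\sum_(0 <= n <oo) g n x)%E.
have gC n : 4 ^+ n * (f_ n.+1 x - f_ n x) ^+ 2 <= C.
  rewrite -lee_fin /C fineK //.
  apply: le_trans (nneseries_lim_ge n.+1 _); last by move=> m _ _; exact: g0.
  rewrite big_nat_recr //= -/(g n x) leeDr // sume_ge0 // => m _; exact: g0.
have C0 : 0 <= C by apply: le_trans (gC 0%N); rewrite mulr_ge0 ?sqr_ge0.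
have : cvgn (series (telescope (f_^~ x))).
  apply: (@normed_cvg R R^o).
  apply: (@series_le_cvg _ _ (geometric (1 + C) 2^-1)).
  - by move=> n; exact: normr_ge0.
  - by move=> n; rewrite /geometric /= mulr_ge0 ?exprn_ge0 ?invr_ge0 //; lra.
  - move=> n; rewrite /geometric /telescope /= exprVn ler_pdivlMr ?exprn_gt0 //.
    have := gC n; rewrite (_ : 4 = 2 ^+ 2 :> R); last by ring.
    rewrite exprAC -exprMn -[X in X <= _]real_normK ?num_real // normrM.
    rewrite (ger0_norm (exprn_ge0 n _)) // mulrC.
    set y := _ * _ => y2; rewrite leNgt; apply/negP => lt; move: y2.
    by rewrite leNgt => /negP; apply; nra.
  - by apply: is_cvg_geometric_series; rewrite ger0_norm; lra.
move=> /cvg_ex[l hl]; apply/cvg_ex; exists (f_ 0%N x + l).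
rewrite (_ : f_ ^~ x = (fun n => f_ 0%N x + series (telescope (f_^~ x)) n)).
  by apply: cvgD hl; exact: cvg_cst.
by apply/funext => n; exact: (eq_sum_telescope (f_ ^~ x)).
Qed.

End square_integrable.

(** * Measurability and null sets in products *)

Lemma measurable_rV_box {R : realType} {N : nat} (A : 'I_N -> set R) :
  (forall i, measurable (A i)) ->
  measurable [set x : 'rV[R]_N | forall i, A i (x ord0 i)].
Proof.
move=> mA; rewrite (_ : mkset _ = \bigcap_(i in [set: 'I_N])
    ((fun x : 'rV[R]_N => x ord0 i) @^-1` A i)).
  apply: fin_bigcap_measurable => // i _.
  by rewrite -[X in measurable X]setTI; exact: measurable_coor.
by apply/seteqP; split => x /= h i; [move=> _|]; exact: h.
Qed.

(** An open set is the countable union of the boxes with rational centre and radius that it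
    contains. *)
Lemma open_measurable_rV {R : realType} {N : nat} (A : set 'rV[R]_N) :
  open A -> measurable A.
Proof.
move=> oA.
pose box (p : 'rV[rat]_N * rat) := [set x : 'rV[R]_N | forall i,
  ball (ratr (p.1 ord0 i) : R) (ratr p.2) (x ord0 i)].
pose F p := if `[< box p `<=` A >] then box p else set0.
rewrite (_ : A = \bigcup_p F p); last first.
  apply/seteqP; split => [x Ax|x [p _]]; last first.
    by rewrite /F; case: asboolP => // + px; apply.
  have /nbhs_ballP[e /= e0 xeA] : nbhs x A by exact: open_nbhs_nbhs.
  have [r] := @rat_in_itvoo R 0 (e / 2) (divr_gt0 e0 (ltr0Sn _ _)).
  rewrite in_itv /= => /andP[r0 re].
  have /choice[c cP] (i : 'I_N) : exists q : rat, ball (ratr q : R) (ratr r) (x ord0 i).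
    have [q] := @rat_in_itvoo R (x ord0 i - ratr r) (x ord0 i + ratr r) ltac:(lra).
    rewrite in_itv /= => /andP[q1 q2]; exists q.
    by rewrite /ball /= ltr_norml; apply/andP; split; lra.
  have xbox : box (\row_i c i, r) x by move=> i /=; rewrite mxE; exact: cP.
  exists (\row_i c i, r) => //; rewrite /F asboolT // => y yb.
  apply: xeA; split=> // i j; rewrite (ord1 i).
  have := yb j; have := xbox j; rewrite /ball /= => h1 h2.
  have -> : x ord0 j - y ord0 j =
      (ratr ((\row_i c i) ord0 j) - y ord0 j) - (ratr ((\row_i c i) ord0 j) - x ord0 j).
    by ring.
  by apply: (le_lt_trans (ler_normB _ _)); lra.
apply: countable_bigcupT_measurable.
  exact: (@countableP ('rV[rat]_N * rat)%type [set: _]).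
move=> p; rewrite /F; case: asboolP => // _.
apply: (measurable_rV_box (A := fun i => ball (ratr (p.1 ord0 i) : R) (ratr p.2))) => i.
exact: measurable_ball.
Qed.

Section product_ae.
Context d1 d2 (T1 : measurableType d1) (T2 : measurableType d2) (R : realType).
Variables (m1 : {measure set T1 -> \bar R})
  (m2 : {sigma_finite_measure set T2 -> \bar R}).

(** The product of a null set with the whole space is null, since $0\cdot\infty=0$. *)
Lemma ae_product_fst (P : T1 -> Prop) : {ae m1, forall x, P x} ->
  {ae (m1 \x m2)%E, forall z, P z.1}.
Proof.
move=> [Z [mZ Z0 PZ]]; exists (Z `*` setT); split.
- exact: measurableX.
- by rewrite product_measure1E // Z0 mul0e.
- by move=> z nPz; split => //; exact: PZ.
Qed.

Lemma ae_product_snd (P : T2 -> Prop) : {ae m2, forall x, P x} ->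
  {ae (m1 \x m2)%E, forall z, P z.2}.
Proof.
move=> [Z [mZ Z0 PZ]]; exists (setT `*` Z); split.
- exact: measurableX.
- by rewrite product_measure1E // Z0 mule0.
- by move=> z nPz; split => //; exact: PZ.
Qed.

End product_ae.

(** * Completeness from a weaker bound at the limit *)

Section complete_bound.
Context {R : realType} {V : lmodType R}.

(** Bounding [D] and [L] separately by Fatou costs a factor 2. It is removed by passing through a
    distant term [u_ p], whose distance to [u] is negligible. *)
Lemma complete_form_of_bound (X : set V) B : subspace X -> psd_form X B ->
  (forall u_ : nat -> V, (forall n, X (u_ n)) ->
    (forall n m, (n <= m)%N -> B (u_ m - u_ n) (u_ m - u_ n) <= 16 ^- n) ->
    exists2 u, X u & forall n, B (u - u_ n) (u - u_ n) <= 2 * 16 ^- n) ->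
  complete_form X B.
Proof.
move=> sX fB H u_ Xu_ cu; have [u Xu uP] := H u_ Xu_ cu; exists u => // n.
rewrite -subr_le0; apply: (@le_geometric_le0 _ _ 6) => m.
(* Since [p >= 2 * m], the square of [u - u_ p] is at most twice [(16 ^- m) ^+ 2], so the cross term
   given by Cauchy-Schwarz is still of order [16 ^- m]. *)
set p := maxn n (2 * m).
have Xh : X (u - u_ p) by exact: (subspaceB sX).
have Xk : X (u_ p - u_ n) by exact: (subspaceB sX).
have -> : u - u_ n = (u - u_ p) + (u_ p - u_ n) by rewrite addrA subrK.
rewrite (form_sqD sX fB) //.
have hk := form_CS sX fB Xh Xk; have h := uP p; have k := cu n p (leq_maxl _ _).
have h0 := form_ge0 fB Xh; have k0 := form_ge0 fB Xk.
have r_le := @geometric_le R.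
have rp : 16 ^- p <= (16 ^- m) ^+ 2 :> R.
  by rewrite exprVn -exprM mulnC r_le // leq_maxr.
have r1 : 16 ^- m <= 1 :> R by have := r_le 0%N m (leq0n _); rewrite expr0 invr1.
have rn : 16 ^- n <= 1 :> R by have := r_le 0%N n (leq0n _); rewrite expr0 invr1.
have r0 : 0 < 16 ^- m :> R by rewrite invr_gt0 exprn_gt0.
move: hk h k h0 k0 rp r1 rn r0.
set x := B (u - u_ p) (u - u_ p); set y := B (u - _) (u_ p - _).
set z := B (u_ p - _) _; set r := 16 ^- m.
set rn := 16 ^- n => hk h k h0 k0 rp r1 rn1 r0.
have x2 : x <= 2 * r ^+ 2 by lra.
have y2 : y ^+ 2 <= 2 * r ^+ 2 by nra.
have : y <= 2 * r by rewrite leNgt; apply/negP; nra.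
have : r ^+ 2 <= r by nra.
lra.
Qed.

End complete_bound.

(** * The space X^s as a complete space *)

Section fractional_space.
Context {R : realType} {N : nat}.
Variables (s : R) (Omega : set 'rV[R]_N).
Local Notation mu := (@lebesgue_rV R N).
Local Notation fspace := (('rV[R]_N -> R^o) : lmodType R).
Local Notation X := (Xs s Omega : set fspace).
Implicit Types (u v : 'rV[R]_N -> R) (z : 'rV[R]_N * 'rV[R]_N).

(** With half of the exponent, the Gagliardo form becomes the $L^2$ product of two such quotients,
    and the lemmas on square integrable functions apply. *)
Definition diffquot u z : R :=
  (u z.1 - u z.2) * enorm (z.1 - z.2) `^ (- ((N%:R + 2 * s) / 2)).

Lemma gagliardo_integrandE u v z :
  gagliardo_integrand s u v z = diffquot u z * diffquot v z.
Proof.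
rewrite /gagliardo_integrand /diffquot -powRN mulrACA -expr2.
rewrite -[_ ^+ 2]powR_mulrn ?powR_ge0 // -powRrM; congr (_ * _ `^ _); lra.
Qed.

Lemma XdotE u v :
  Xdot s u v = L2prod (mu \x mu)%E setT (diffquot u) (diffquot v).
Proof. by apply: eq_Rintegral => z _; exact: gagliardo_integrandE. Qed.

Lemma diffquot_lin (c : R) u v :
  diffquot (fun x => c * u x + v x) = (fun z => c * diffquot u z + diffquot v z).
Proof. by apply/funext => z; rewrite /diffquot; ring. Qed.

Lemma measurable_enorm_sub :
  measurable_fun setT (fun z : 'rV[R]_N * 'rV[R]_N => enorm (z.1 - z.2)).
Proof.
have msqrt : measurable_fun setT (@Num.sqrt R).
  by apply: continuous_measurable_fun; exact: sqrt_continuous.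
suff mdot : measurable_fun setT
    (fun z : 'rV[R]_N * 'rV[R]_N => dotr (z.1 - z.2) (z.1 - z.2)).
  exact: (measurableT_comp msqrt mdot).
rewrite /dotr; apply: measurable_sum => i.
rewrite (_ : (fun z => _) = (fun z : 'rV[R]_N * 'rV[R]_N =>
    (z.1 ord0 i - z.2 ord0 i) * (z.1 ord0 i - z.2 ord0 i))); last first.
  by apply/funext => z; rewrite !mxE.
have m1 : measurable_fun setT (fun z : 'rV[R]_N * 'rV[R]_N => z.1 ord0 i).
  by apply: (measurableT_comp (measurable_coor i)); exact: measurable_fst.
have m2 : measurable_fun setT (fun z : 'rV[R]_N * 'rV[R]_N => z.2 ord0 i).
  by apply: (measurableT_comp (measurable_coor i)); exact: measurable_snd.
by apply: measurable_funM; exact: measurable_funB.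
Qed.

Lemma measurable_diffquot u : measurable_fun setT u ->
  measurable_fun setT (diffquot u).
Proof.
move=> mu_; apply: measurable_funM.
  apply: measurable_funB.
    by apply: (measurableT_comp mu_); exact: measurable_fst.
  by apply: (measurableT_comp mu_); exact: measurable_snd.
exact: (measurableT_comp (measurable_powR _) measurable_enorm_sub).
Qed.

Lemma Lfun2P d (T : measurableType d) (m : {measure set T -> \bar R}) (f : T -> R) :
  f \in Lfun m 2%:E <-> sqint m setT f.
Proof.
split=> [f2|[mf f2]].
  apply: integrable_sqint; last exact: Lfun2_integrable_sqr.
  by move: f2; rewrite inE => /andP[/[!inE]].
rewrite inE; apply/andP; split; rewrite inE //= /finite_norm unlock.
apply: poweR_lty; apply: le_lt_trans f2; rewrite le_eqVlt; apply/orP; left.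
apply/eqP; apply: eq_integral => x _ /=; rewrite powR_mulrn //.
by rewrite -normrX ger0_norm // sqr_ge0.
Qed.

Lemma XsP u : Xs s Omega u <-> [/\ sqint mu setT u,
  sqint (mu \x mu)%E setT (diffquot u) & {ae mu, forall x, ~ Omega x -> u x = 0}].
Proof.
have E : (\int[(mu \x mu)%E]_z (gagliardo_integrand s u u z)%:E =
    \int[(mu \x mu)%E]_z (diffquot u z ^+ 2)%:E)%E.
  by apply: eq_integral => z _; rewrite gagliardo_integrandE.
split=> [[u2 Du u0]|[u2 [mDu Du] u0]].
  have u2' : sqint mu setT u by apply/Lfun2P.
  split => //; split; last by rewrite -E.
  exact: measurable_diffquot u2'.1.
by split=> //; [apply/Lfun2P|rewrite E].
Qed.

Lemma Xs_subspace : subspace X.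
Proof.
split.
  apply/XsP; split; [exact: (subspace0 (sqint_subspace _ measurableT))| |].
    rewrite (_ : diffquot _ = 0).
      exact: (subspace0 (sqint_subspace _ measurableT)).
    by apply/funext => z; rewrite /diffquot subrr mul0r.
  exact: nearW.
move=> c u v /XsP[u2 Du u0] /XsP[v2 Dv v0]; apply/XsP; split.
- exact: (sqint_lin measurableT c u2 v2).
- rewrite (_ : diffquot _ = (fun z => c * diffquot u z + diffquot v z)).
    exact: (sqint_lin measurableT c Du Dv).
  exact: diffquot_lin.
- apply: filterS2 u0 v0 => x u0 v0 xO.
  by rewrite -[LHS]/(c * u x + v x) u0 // v0 // mulr0 addr0.
Qed.

Lemma Xdot_form : psd_form X (Xdot s).
Proof.
have fD := L2prod_form (mu \x mu)%E (measurableT : measurable [set: 'rV[R]_N * 'rV[R]_N]).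
split=> [c u v w /XsP[_ Du _] /XsP[_ Dv _] /XsP[_ Dw _]|
         u v /XsP[_ Du _] /XsP[_ Dv _]|u /XsP[_ Du _]]; rewrite !XdotE.
- rewrite (_ : diffquot _ = (fun z => c * diffquot u z + diffquot v z)).
    exact: (form_lin fD).
  exact: diffquot_lin.
- exact: (form_sym fD).
- exact: (form_ge0 fD).
Qed.

Lemma Xnorm_sqr u : Xs s Omega u -> Xnorm s u ^+ 2 = Xdot s u u.
Proof. by move=> Xu; rewrite /Xnorm sqr_sqrtr //; exact: (form_ge0 Xdot_form). Qed.

Hypothesis mO : measurable Omega.

Lemma Xs_sqint_Omega u : Xs s Omega u -> sqint mu Omega u.
Proof.
move=> /XsP[[mu_ u2] _ _]; split; first exact: measurable_funTS.
apply: le_lt_trans u2; apply: ge0_subset_integral => //.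
- by apply/measurable_EFinP; exact: measurable_funX.
- by move=> x _; rewrite lee_fin sqr_ge0.
Qed.

Lemma L2prod_Xs_form : psd_form X (L2prod mu Omega).
Proof.
have fL := L2prod_form mu mO.
split=> [c u v w Xu Xv Xw|u v Xu Xv|u Xu].
- by apply: (form_lin fL); exact: Xs_sqint_Omega.
- by apply: (form_sym fL); exact: Xs_sqint_Omega.
- by apply: (form_ge0 fL); exact: Xs_sqint_Omega.
Qed.

Lemma Xs_integral_Omega u : Xs s Omega u ->
  (\int[mu]_x (u x ^+ 2)%:E = \int[mu]_(x in Omega) (u x ^+ 2)%:E)%E.
Proof.
move=> /XsP[[mu_ u2] _ u0]; rewrite [RHS]integral_mkcond.
have m2 : measurable_fun setT (fun x => (u x ^+ 2)%:E).
  by apply/measurable_EFinP; exact: measurable_funX.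
apply: ge0_ae_eq_integral => //.
- by apply/(measurable_restrictT _ mO); exact: measurable_funTS.
- by move=> x _; rewrite lee_fin sqr_ge0.
- by move=> x _; rewrite patchE; case: ifP => // _; rewrite lee_fin sqr_ge0.
- apply: filterS u0 => x u0 _; rewrite patchE; case: ifPn => // /negP xO.
  by rewrite u0 ?expr0n // => Ox; apply: xO; rewrite inE.
Qed.

Lemma L2prod_ae_zero u : Xs s Omega u -> L2prod mu Omega u u = 0 -> ae_zero u.
Proof.
move=> Xu u0; have [[mu_ _] _ _] := (XsP u).1 Xu.
have : (\int[mu]_x `| (u x ^+ 2)%:E | = 0)%E.
  rewrite (eq_integral (fun x => (u x ^+ 2)%:E)) => [|x _]; last first.
    by rewrite gee0_abs // lee_fin sqr_ge0.
  by rewrite Xs_integral_Omega // (L2prod_EFin mO) ?u0 //; exact: Xs_sqint_Omega.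
have m2 : measurable_fun setT (fun x => (u x ^+ 2)%:E).
  by apply/measurable_EFinP; exact: measurable_funX.
move=> /(ae_eq_integral_abs mu measurableT m2); apply: filterS => x /(_ I).
by move=> /eqP; rewrite eqe sqrf_eq0 => /eqP.
Qed.

Lemma ae_zero_L2prod u v : ae_zero u -> Xs s Omega u -> Xs s Omega v ->
  L2prod mu Omega u v = 0.
Proof.
move=> u0 Xu Xv; rewrite /L2prod /Rintegral (ae_eq_integral (cst 0%E)) //.
- by rewrite integral0.
- apply/measurable_EFinP; apply: measurable_funM.
    exact: (Xs_sqint_Omega Xu).1.
  exact: (Xs_sqint_Omega Xv).1.
- by apply: filterS u0 => x /= -> _; rewrite mul0r.
Qed.

(** A fast Cauchy sequence converges almost everywhere, on [Omega] by the $L^2$ bounds and elsewhere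
    because its terms vanish. Fatou, for the functions and for their difference quotients, carries
    the bounds to the limit. *)
Lemma Xs_complete : complete_form X (form_add (Xdot s) (L2prod mu Omega)).
Proof.
have sX := Xs_subspace; have fD := Xdot_form; have fL := L2prod_Xs_form.
apply: complete_form_of_bound => //; first exact: psd_form_add.
move=> u_ Xu_ cu; have Xh n m : X (u_ m - u_ n) by exact: (subspaceB sX).
have meas_u_ n : measurable_fun setT (u_ n) by have [[]] := (XsP _).1 (Xu_ n).
have cL n m : (n <= m)%N -> L2prod mu Omega (u_ m - u_ n) (u_ m - u_ n) <= 16 ^- n.
  by move=> nm; have := cu n m nm; have := form_ge0 fD (Xh n m); rewrite /form_add; lra.
have cD n m : (n <= m)%N -> Xdot s (u_ m - u_ n) (u_ m - u_ n) <= 16 ^- n.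
  by move=> nm; have := cu n m nm; have := form_ge0 fL (Xh n m); rewrite /form_add; lra.
have cLE n m : (n <= m)%N ->
    (\int[mu]_(x in Omega) ((u_ m - u_ n) x ^+ 2)%:E <= (16 ^- n)%:E)%E.
  move=> nm; rewrite (L2prod_EFin mO) ?lee_fin ?cL //.
  exact: Xs_sqint_Omega (Xh n m).
(* The upper limit is measurable and defined everywhere, and equals the limit wherever there is
   one. *)
pose u x : R := fine (limn_esup (fun n => (u_ n x)%:E)).
have meas_u : measurable_fun setT u.
  have mu' : measurable_fun setT (fun x => limn_esup (fun n => (u_ n x)%:E)).
    by apply: measurable_fun_limn_esup => n; exact/measurable_EFinP.
  exact: (measurableT_comp (fine_measurable measurableT) mu').
have u0_ : {ae mu, forall x, forall n, ~ Omega x -> u_ n x = 0}.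
  by apply: ae_foralln => n; have [] := (XsP _).1 (Xu_ n).
have uE x l : u_ n x @[n --> \oo] --> l -> u x = l.
  move=> ul; rewrite /u.
  have : (u_ n x)%:E @[n --> \oo] --> l%:E by apply: cvg_EFin => //; exact: nearW.
  by move=> /cvg_limn_einf_sup[_ ->].
have u_u : {ae mu, forall x, u_ n x @[n --> \oo] --> u x}.
  have aO : {ae mu, forall x, Omega x -> cvgn (u_ ^~ x)}.
    apply: fast_cauchy_ae_cvg => // [n|n]; first exact: measurable_funTS.
    exact: cLE.
  apply: filterS2 aO u0_ => x xO x0; have [Ox|Ox] := pselect (Omega x).
    by have /cvg_ex[l ul] := xO Ox; rewrite (uE _ _ ul).
  have ul : u_ n x @[n --> \oo] --> (0 : R).
    by apply: cvg_near_cst; apply: nearW => n; rewrite x0.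
  by rewrite (uE _ _ ul).
have u0 : {ae mu, forall x, ~ Omega x -> u x = 0}.
  apply: filterS u0_ => x x0 Ox; apply: uE.
  by apply: cvg_near_cst; apply: nearW => n; rewrite x0.
have shift k : {ae mu, forall x, (u_ (n + k)%N - u_ k) x @[n --> \oo] --> (u - u_ k) x}.
  apply: filterS u_u => x ux.
  apply: (@cvgB _ R^o _ _ _ (fun n => u_ (n + k)%N x) (fun=> u_ k x) (u x) (u_ k x)).
    by rewrite (cvg_shiftn k (u_ ^~ x)).
  exact: cvg_cst.
have meas_h (v w : 'rV[R]_N -> R^o) : measurable_fun setT v -> measurable_fun setT w ->
    measurable_fun setT (v - w) by move=> *; exact: measurable_funB.
have uT k : (\int[mu]_x ((u - u_ k) x ^+ 2)%:E <= (16 ^- k)%:E)%E.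
  apply: (fatou_sqint measurableT (f_ := fun n => u_ (n + k)%N - u_ k)).
  - by move=> n; exact: meas_h.
  - exact: meas_h.
  - by apply: filterS (shift k).
  - by move=> n; rewrite (Xs_integral_Omega (Xh _ _)); apply: cLE; exact: leq_addl.
have uD k : (\int[(mu \x mu)%E]_z (diffquot (u - u_ k) z ^+ 2)%:E <= (16 ^- k)%:E)%E.
  apply: (fatou_sqint measurableT (f_ := fun n => diffquot (u_ (n + k)%N - u_ k))).
  - by move=> n; apply: measurable_diffquot; exact: meas_h.
  - by apply: measurable_diffquot; exact: meas_h.
  - apply: filterS2 (ae_product_fst mu (shift k)) (ae_product_snd mu (shift k)).
    move=> z z1 z2 _; rewrite /diffquot; apply: cvgMl.
    exact: (@cvgB _ R^o).
  - move=> n; have [_ Dh _] := (XsP _).1 (Xh k (n + k)%N).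
    by rewrite (L2prod_EFin measurableT Dh) lee_fin -XdotE cD // leq_addl.
have XU k : X (u - u_ k).
  apply/XsP; split.
  - by split; [exact: meas_h|apply: le_lt_trans (uT k) _; exact: ltry].
  - split; first by apply: measurable_diffquot; exact: meas_h.
    by apply: le_lt_trans (uD k) _; exact: ltry.
  - apply: filterS2 u0 u0_ => x ux u_x Ox.
    by rewrite -[LHS]/(u x - u_ k x) ux // u_x // subrr.
exists u => [|k].
  by rewrite -(subrK (u_ 0%N) u); apply: (subspaceD sX).
have [U2 DU _] := (XsP _).1 (XU k).
have := uT k; rewrite (Xs_integral_Omega (XU k)).
rewrite (L2prod_EFin mO (Xs_sqint_Omega (XU k))) lee_fin => hL.
have := uD k; rewrite (L2prod_EFin measurableT DU) lee_fin -XdotE => hD.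
by rewrite /form_add; lra.
Qed.

End fractional_space.

(** * A double integral identity *)

Lemma fubini_tonelli_setX d1 d2 (T1 : measurableType d1)
    (T2 : measurableType d2) (R : realType)
    (m1 : {sigma_finite_measure set T1 -> \bar R})
    (m2 : {sigma_finite_measure set T2 -> \bar R})
    (A : set T1) (B : set T2) (f : T1 * T2 -> \bar R) :
  measurable A -> measurable B -> measurable_fun setT f ->
  (forall z, 0 <= f z)%E ->
  (\int[(m1 \x m2)%E]_(z in A `*` B) f z =
   \int[m1]_(x in A) \int[m2]_(y in B) f (x, y))%E.
Proof.
move=> mA mB mf f0; have mAB := measurableX mA mB.
rewrite integral_mkcond fubini_tonelli1; last 2 first.
- by apply/(measurable_restrictT _ mAB); exact: measurable_funTS.
- by move=> z; rewrite patchE; case: ifP.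
rewrite [RHS]integral_mkcond; apply: eq_integral => x _.
rewrite /fubini_F patchE; case: ifPn => [xA|xA].
  rewrite [RHS]integral_mkcond; apply: eq_integral => y _.
  rewrite !patchE; congr (if _ then _ else _); apply/idP/idP; rewrite !inE /=.
    by case.
  by move=> yB; split => //; rewrite inE in xA.
rewrite (eq_integral (cst 0%E)) ?integral0 // => y _; rewrite patchE.
by case: ifPn => //; rewrite inE => -[/= xA' _]; rewrite notin_setE in xA.
Qed.

Section finite_partition.
Context d (T : measurableType d) (R : realType) (m : {measure set T -> \bar R}).
Context (I : finType) (Q : I -> set T) (f : T -> \bar R).
Hypotheses (mQ : forall i, measurable (Q i)) (tQ : trivIset setT Q).
Hypotheses (mf : measurable_fun setT f) (f0 : forall x, (0 <= f x)%E).

Let integral_union : (\int[m]_(x in \big[setU/set0]_i Q i) f x =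
  \sum_i \int[m]_(x in Q i) f x)%E.
Proof.
apply: ge0_integral_bigsetU => //.
- exact: index_enum_uniq.
- exact: sub_trivIset tQ.
- exact: measurable_funTS.
Qed.

Let mU : measurable (\big[setU/set0]_i Q i).
Proof. exact: bigsetU_measurable. Qed.

Lemma sum_integral_le_setT :
  (\sum_i \int[m]_(x in Q i) f x <= \int[m]_x f x)%E.
Proof. by rewrite -integral_union; apply: ge0_subset_integral. Qed.

Lemma integral_cover_le A : measurable A -> A `<=` \bigcup_i Q i ->
  (\int[m]_(x in A) f x <= \sum_i \int[m]_(x in Q i) f x)%E.
Proof.
move=> mA AQ; rewrite -integral_union; apply: ge0_subset_integral => //.
  exact: measurable_funTS.
move=> x /AQ[i _ Qx]; rewrite -bigcup_seq; exists i => //=.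
exact: mem_index_enum.
Qed.

End finite_partition.

Section double_integral.
Context d (T : measurableType d) (R : realType).
Variables (m : {sigma_finite_measure set T -> \bar R}) (Q : set T).
Hypotheses (mQ : measurable Q) (Qfin : (m Q < +oo)%E).
Variable u : T -> R.
Hypotheses (mu_ : measurable_fun setT u) (u2 : sqint m Q u).

Let q := fine (m Q).
Let A := \int[m]_(x in Q) u x.
Let B := L2prod m Q u u.

Let one2 : sqint m Q (cst 1).
Proof.
split; first exact: measurable_cst.
under eq_integral => x _ do rewrite /= expr1n.
by rewrite integral_cst // mul1e.
Qed.

Lemma sqint_integrable_finite : m.-integrable Q (fun x => (u x)%:E).
Proof.
have := sqint_mul mQ u2 one2; apply: eq_integrable => // x _ /=.
by rewrite mulr1.
Qed.

Let integral_quadratic (a b c : R) :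
  (\int[m]_(x in Q) (a * u x ^+ 2 + b * u x + c)%:E =
   (a * B + b * A + c * q)%:E)%E.
Proof.
have i2 := integrableZl mQ a (sqint_integrable u2).
have i1 := integrableZl mQ b sqint_integrable_finite.
have i0 : m.-integrable Q (cst c%:E).
  apply: eq_integrable (integrableZl mQ c (sqint_integrable one2)) => //.
  by move=> x _ /=; rewrite -EFinM expr1n mulr1.
under eq_integral => x _ do rewrite !EFinD !EFinM.
rewrite (integralD mQ (integrableD mQ i2 i1) i0) (integralD mQ i2 i1).
rewrite (integralZl mQ (sqint_integrable u2)) (integralZl mQ sqint_integrable_finite).
rewrite (integral_cst _ mQ) (L2prod_EFin mQ u2).
rewrite !EFinD !EFinM; congr (_ * _ + _ * _ + _ * _)%E.
  by rewrite /A /Rintegral fineK //; exact: integrable_fin_num sqint_integrable_finite.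
by rewrite /q fineK // ge0_fin_numE.
Qed.

(** This is the variance identity. The integral over [y] of the expanded square is again a quadratic
    polynomial in [u x], so [integral_quadratic] is applied twice. *)
Lemma double_integral_sq_sub :
  (\int[(m \x m)%E]_(z in Q `*` Q) ((u z.1 - u z.2) ^+ 2)%:E =
   (2 * (fine (m Q) * L2prod m Q u u - (\int[m]_(x in Q) u x) ^+ 2))%:E)%E.
Proof.
rewrite -/q -/A -/B fubini_tonelli_setX //; last 2 first.
- apply/measurable_EFinP; apply: measurable_funX; apply: measurable_funB.
    exact: (measurableT_comp mu_ measurable_fst).
  exact: (measurableT_comp mu_ measurable_snd).
- by move=> z; rewrite lee_fin sqr_ge0.
rewrite (eq_integral (fun x => (q * u x ^+ 2 + (- 2 * A) * u x + B)%:E)).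
  by rewrite integral_quadratic; congr (_%:E); ring.
move=> x _ /=.
rewrite (eq_integral (fun y => (1 * u y ^+ 2 + (- 2 * u x) * u y + u x ^+ 2)%:E)).
  by rewrite integral_quadratic; congr (_%:E); ring.
by move=> y _; congr (_%:E); ring.
Qed.

End double_integral.

(** * Compactness *)

Section cubes.
Context {R : realType} {N : nat}.
Local Notation mu := (@lebesgue_rV R N).

(* The box [-a, a[^N is cut into m^N cubes. *)
Definition cube (a : R) (m : nat) (f : {ffun 'I_N -> 'I_m}) : set 'rV[R]_N :=
  [set x | forall i, `[- a + (f i)%:R * (2 * a / m%:R),
                     - a + (f i)%:R * (2 * a / m%:R) + 2 * a / m%:R[%classic
                     (x ord0 i)].

Lemma cube_measurable a m f : measurable (@cube a m f).
Proof.
apply: (measurable_rV_box (A := fun i => `[- a + (f i)%:R * (2 * a / m%:R),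
  - a + (f i)%:R * (2 * a / m%:R) + 2 * a / m%:R[%classic)) => i.
exact: measurable_itv.
Qed.

Lemma cube_measure a m f : 0 < a -> (0 < m)%N ->
  mu (@cube a m f) = ((2 * a / m%:R) ^+ N)%:E.
Proof.
move=> a0 m0; have d0 : 0 < 2 * a / m%:R by rewrite divr_gt0 ?ltr0n // mulr_gt0.
rewrite (lebesgue_rV_box (A := fun i => `[- a + (f i)%:R * (2 * a / m%:R),
  - a + (f i)%:R * (2 * a / m%:R) + 2 * a / m%:R[%classic)); last first.
  by move=> i; exact: measurable_itv.
rewrite (eq_bigr (fun=> (2 * a / m%:R)%:E)) => [|i _].
  by rewrite -(big_morph _ (@EFinM R) erefl) prodr_const card_ord.
rewrite lebesgue_measure_itv /= lte_fin ltrDl d0 -EFinB; congr (_%:E); ring.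
Qed.

Lemma cube_trivIset a m : 0 < a -> (0 < m)%N -> trivIset setT (@cube a m).
Proof.
move=> a0 m0; have d0 : 0 < 2 * a / m%:R by rewrite divr_gt0 ?ltr0n // mulr_gt0.
move=> f g _ _ [x [xf xg]]; apply/ffunP => i.
have := xf i; have := xg i; rewrite /= !in_itv /= => /andP[g1 g2] /andP[f1 f2].
have le (p q : nat) : - a + p%:R * (2 * a / m%:R) <= x ord0 i ->
    x ord0 i < - a + q%:R * (2 * a / m%:R) + 2 * a / m%:R -> (p <= q)%N.
  move=> h1 h2; rewrite -ltnS -(ltr_nat R) -(ltr_pM2r d0) -natr1 mulrDl mul1r.
  lra.
by apply/val_inj/eqP; rewrite eqn_leq !le.
Qed.

Lemma cube_cover a m (x : 'rV[R]_N) : 0 < a -> (0 < m)%N ->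
  (forall i, `|x ord0 i| < a) -> exists f, @cube a m f x.
Proof.
move=> a0 m0 xa; have d0 : 0 < 2 * a / m%:R by rewrite divr_gt0 ?ltr0n // mulr_gt0.
have tP i : (Num.trunc ((x ord0 i + a) / (2 * a / m%:R)) < m)%N /\
    (Num.trunc ((x ord0 i + a) / (2 * a / m%:R)))%:R * (2 * a / m%:R)
      <= x ord0 i + a <
    (Num.trunc ((x ord0 i + a) / (2 * a / m%:R)))%:R * (2 * a / m%:R) + 2 * a / m%:R.
  have := xa i; rewrite ltr_norml => /andP[x1 x2].
  have q0 : 0 <= (x ord0 i + a) / (2 * a / m%:R) by rewrite divr_ge0 ?ltW //; lra.
  have /andP[] := truncn_itv q0; set t := Num.trunc _.
  rewrite ler_pdivlMr // ltr_pdivrMr // -(natr1 t) (mulrDl t%:R) mul1r => t1 t2.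
  split; last by rewrite t1 t2.
  rewrite -(ltr_nat R) -(ltr_pM2r d0); apply: (le_lt_trans t1).
  by rewrite mulrC divfK ?pnatr_eq0 -?lt0n //; lra.
exists [ffun i => Ordinal (tP i).1] => i; rewrite /= ffunE /= in_itv /=.
by have /andP[] := (tP i).2; move=> *; apply/andP; split; lra.
Qed.

Lemma cube_diameter a m f (x y : 'rV[R]_N) : 0 < a -> (0 < m)%N ->
  @cube a m f x -> @cube a m f y ->
  enorm (x - y) <= Num.sqrt N%:R * (2 * a / m%:R).
Proof.
move=> a0 m0 xf yf; have d0 : 0 < 2 * a / m%:R by rewrite divr_gt0 ?ltr0n // mulr_gt0.
rewrite -[X in _ * X](gtr0_norm d0) -sqrtr_sqr -sqrtrM ?ler0n // ler_wsqrtr //.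
rewrite /dotr -[in leRHS](card_ord N) mulr_natl -sumr_const; apply: ler_sum => i _.
have := xf i; have := yf i; rewrite /= !in_itv /= !mxE => /andP[y1 y2] /andP[x1 x2].
rewrite -expr2 -[X in X <= _]real_normK ?num_real // lerXn2r ?nnegrE //.
  exact: ltW.
by rewrite ler_norml; apply/andP; split; lra.
Qed.

Lemma enorm_eq0 (x : 'rV[R]_N) : enorm x = 0 -> x = 0.
Proof.
move=> /eqP; rewrite sqrtr_eq0 => x0; apply/rowP => i; rewrite mxE.
have sq j : 0 <= x ord0 j * x ord0 j by rewrite -expr2 sqr_ge0.
have : dotr x x = 0 by apply/eqP; rewrite eq_le x0 sumr_ge0.
move=> /eqP; rewrite psumr_eq0 // => /allP/(_ i (mem_index_enum _)).
by rewrite /= -expr2 sqrf_eq0 => /eqP.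
Qed.

End cubes.

Section compactness.
Context {R : realType} {N : nat}.
Variables (s : R) (Omega : set 'rV[R]_N).
Hypotheses (s0 : 0 < s) (mO : measurable Omega) (bO : bounded_set Omega).
Local Notation mu := (@lebesgue_rV R N).
Local Notation X := (Xs s Omega : set (('rV[R]_N -> R^o) : lmodType R)).

(** Off the diagonal the quotient of $r^{N+2s}$ by $|x-y|^{N+2s}$ is at least 1; on it the left side
    is 0. *)
Lemma sq_sub_le_diffquot u z (r : R) : enorm (z.1 - z.2) <= r ->
  (u z.1 - u z.2) ^+ 2 <= r `^ (N%:R + 2 * s) * @diffquot R N s u z ^+ 2.
Proof.
have p0 : 0 <= N%:R + 2 * s by rewrite addr_ge0 ?ler0n // mulr_ge0 // ltW.
move=> zr; have [E0|E0] := eqVneq (enorm (z.1 - z.2)) 0.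
  move/enorm_eq0/eqP: E0; rewrite subr_eq0 => /eqP ->.
  by rewrite subrr expr0n mulr_ge0 ?powR_ge0 ?sqr_ge0.
have E1 : 0 < enorm (z.1 - z.2) by rewrite lt_neqAle eq_sym E0 sqrtr_ge0.
have -> : diffquot s u z ^+ 2 =
    (u z.1 - u z.2) ^+ 2 / enorm (z.1 - z.2) `^ (N%:R + 2 * s).
  by rewrite expr2 -gagliardo_integrandE.
rewrite mulrCA ler_peMr ?sqr_ge0 // ler_pdivlMr ?powR_gt0 // mul1r.
by apply: ge0_ler_powR; rewrite ?nnegrE // ltW // (lt_le_trans E1).
Qed.

(** By the variance identity, the integral of [u ^+ 2] is the double integral of the squared
    differences over twice the volume, plus the squared mean term. The differences are bounded with
    the diameter of the cube. *)
Lemma cube_poincare a m (f : {ffun 'I_N -> 'I_m}) u : 0 < a -> (0 < m)%N ->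
  measurable_fun setT u -> sqint mu (cube a f) u ->
  sqint (mu \x mu)%E setT (diffquot s u) ->
  (\int[mu]_(x in cube a f) (u x ^+ 2)%:E <=
    ((Num.sqrt N%:R * (2 * a / m%:R)) `^ (N%:R + 2 * s) /
       (2 * (2 * a / m%:R) ^+ N))%:E *
      \int[(mu \x mu)%E]_(z in cube a f `*` cube a f) (diffquot s u z ^+ 2)%:E
    + (((\int[mu]_(x in cube a f) u x) / Num.sqrt ((2 * a / m%:R) ^+ N)) ^+ 2)%:E)%E.
Proof.
move=> a0 m0 mu_ u2 Du; have d0 : 0 < 2 * a / m%:R by rewrite divr_gt0 ?ltr0n // mulr_gt0.
set r := Num.sqrt _ * _; set q := (2 * a / m%:R) ^+ N.
have q0 : 0 < q by rewrite exprn_gt0.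
have mQ := cube_measurable a f; have mQQ := measurableX mQ mQ.
have muQ := cube_measure f a0 m0.
have Qfin : (mu (cube a f) < +oo)%E by rewrite muQ ltry.
have := double_integral_sq_sub mQ Qfin mu_ u2; rewrite muQ /= -/q => dE.
have mT := measurable_diffquot s mu_.
have r0 : 0 <= r `^ (N%:R + 2 * s) by exact: powR_ge0.
have : ((2 * (q * L2prod mu (cube a f) u u - (\int[mu]_(x in cube a f) u x) ^+ 2))%:E <=
    (r `^ (N%:R + 2 * s))%:E *
    \int[(mu \x mu)%E]_(z in cube a f `*` cube a f) (diffquot s u z ^+ 2)%:E)%E.
  rewrite -dE -ge0_integralZl_EFin //; last 2 first.
  - by move=> z _; rewrite lee_fin sqr_ge0.
  - by apply/measurable_EFinP; apply: measurable_funTS; exact: measurable_funX.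
  apply: ge0_le_integral => //.
  - by move=> z _; rewrite lee_fin sqr_ge0.
  - apply/measurable_EFinP; apply: measurable_funTS; apply: measurable_funX.
    apply: measurable_funB; first exact: (measurableT_comp mu_ measurable_fst).
    exact: (measurableT_comp mu_ measurable_snd).
  - apply/measurable_EFinP; apply: measurable_funTS; apply: measurable_funM => //.
    exact: measurable_funX.
  - move=> z [z1 z2]; rewrite -EFinM lee_fin; apply: sq_sub_le_diffquot.
    exact: (cube_diameter a0 m0 z1 z2).
have : (0 <= \int[(mu \x mu)%E]_(z in cube a f `*` cube a f) (diffquot s u z ^+ 2)%:E)%E.
  by apply: integral_ge0 => z _; rewrite lee_fin sqr_ge0.
rewrite (L2prod_EFin mQ u2).
set A := \int[mu]_(x in _) u x; set B := L2prod _ _ _ _; set c := r `^ _.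
rewrite expr_div_n sqr_sqrtr ?(ltW q0) //.
have : (\int[(mu \x mu)%E]_(z in cube a f `*` cube a f) (diffquot s u z ^+ 2)%:E)%E
    \is a fin_num.
  apply: integrable_fin_num => //.
  by apply: integrableS (sqint_integrable Du).
case: (integral _ _ _) => [I _ I0|//|//].
rewrite -!EFinM -EFinD !lee_fin => h.
have -> : c / (2 * q) * I + A ^+ 2 / q = (c * I + 2 * A ^+ 2) / (2 * q).
  by field; rewrite gt_eqF.
rewrite ler_pdivlMr ?mulr_gt0 //; lra.
Qed.

Lemma coord_le_norm (x : 'rV[R]_N) i : `|x ord0 i| <= `|x|.
Proof.
rewrite {2}/Num.norm /= mx_normrE.
exact: (le_bigmax _ (fun ij : 'I_1 * 'I_N => `|x ij.1 ij.2|) (ord0, i)).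
Qed.

(** For cubes of side [d] the volume [d ^+ N] cancels and the constant is [C * d ^ (2 * s)], which
    tends to 0 with [d] because [s] is positive. *)
Lemma small_mesh a e : 0 < a -> 0 < e -> exists2 m, (0 < m)%N &
  (Num.sqrt N%:R * (2 * a / m%:R)) `^ (N%:R + 2 * s) /
    (2 * (2 * a / m%:R) ^+ N) <= e.
Proof.
move=> a0 e0; set p := N%:R + 2 * s; pose C := (Num.sqrt N%:R : R) `^ p / 2.
have C0 : 0 <= C by rewrite divr_ge0 // powR_ge0.
have eC : 0 < e / (C + 1) by rewrite divr_gt0 //; lra.
pose t := (e / (C + 1)) `^ (2 * s)^-1.
have t0 : 0 < t by rewrite powR_gt0.
have at0 : 0 <= 2 * a / t by rewrite divr_ge0 ?(ltW t0) // mulr_ge0 // ltW.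
have /andP[_ mt] := truncn_itv at0; set m := (Num.trunc _).+1 in mt.
exists m => //; set d := 2 * a / m%:R.
have m0 : 0 < m%:R :> R by rewrite ltr0n.
have d0 : 0 < d by rewrite divr_gt0 // mulr_gt0.
have dt : d <= t.
  by rewrite /d ler_pdivrMr // [t * _]mulrC -ler_pdivrMr // ltW.
have ds : d `^ (2 * s) <= e / (C + 1).
  have -> : e / (C + 1) = t `^ (2 * s).
    by rewrite /t -powRrM mulVf ?powRr1 ?(ltW eC) // gt_eqF // mulr_gt0.
  apply: ge0_ler_powR; rewrite ?nnegrE //; try exact: ltW.
  by rewrite mulr_ge0 // ltW.
have dp : d `^ p = d ^+ N * d `^ (2 * s).
  by rewrite powRD ?(gt_eqF d0) ?implybT // powR_mulrn ?(ltW d0).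
rewrite powRM ?sqrtr_ge0 ?(ltW d0) // dp.
have -> : Num.sqrt N%:R `^ p * (d ^+ N * d `^ (2 * s)) / (2 * d ^+ N) =
    C * d `^ (2 * s).
  by rewrite /C; field; rewrite expf_neq0 // gt_eqF.
apply: (le_trans (ler_wpM2l C0 ds)).
by rewrite mulrA ler_pdivrMr; [nra|lra].
Qed.

(** The Poincare inequalities on the cubes are summed: the cubes cover [Omega], and their squares
    are disjoint in the product, so the double integrals add up to at most the Gagliardo form. *)
Lemma Xs_compact : compact_form X (Xdot s) (L2prod mu Omega).
Proof.
move=> e e0.
have [a a0 aP] : exists2 a : R, 0 < a & forall x, Omega x -> forall i, `|x ord0 i| < a.
  have [M [_ MP]] := bO; exists (`|M| + 2); first by have := normr_ge0 M; lra.
  move=> x Ox i; have := coord_le_norm x i.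
  have hM := ler_norm M; have /MP/(_ x Ox) /= : M < `|M| + 1 by lra.
  by lra.
have [m m0 me] := small_mesh a0 e0.
set c := _ / _ in me.
have mQ (f : {ffun 'I_N -> 'I_m}) := cube_measurable a f.
have tQ := cube_trivIset (N := N) a0 m0.
have d0 : 0 < 2 * a / m%:R by rewrite divr_gt0 ?ltr0n // mulr_gt0.
pose q : R := (2 * a / m%:R) ^+ N; have q0 : 0 < q by rewrite exprn_gt0.
pose l (f : {ffun 'I_N -> 'I_m}) (u : 'rV[R]_N -> R^o) : R :=
  (\int[mu]_(x in cube a f) u x) / Num.sqrt q.
have Qfin f : (mu (@cube R N a m f) < +oo)%E by rewrite cube_measure // ltry.
have uQ f u : X u -> sqint mu (@cube R N a m f) u.
  move=> /XsP[[mu_ u2] _ _]; split; first exact: measurable_funTS.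
  apply: (le_lt_trans _ u2); apply: ge0_subset_integral => //.
    by apply/measurable_EFinP; exact: measurable_funX.
  by move=> x _; rewrite lee_fin sqr_ge0.
exists {ffun 'I_N -> 'I_m}, l; split.
- move=> f u v Xu Xv; rewrite /l -mulrBl; congr (_ / _).
  rewrite -RintegralB //.
    exact: (sqint_integrable_finite (mQ f) (Qfin f) (uQ f _ Xu)).
  exact: (sqint_integrable_finite (mQ f) (Qfin f) (uQ f _ Xv)).
- move=> f; exists 1 => u Xu; rewrite mul1r.
  have [[mu_ u2] _ _] := (XsP _ _ _).1 Xu.
  (* Nonnegativity of the variance is Cauchy-Schwarz on the cube, and bounds the normalized integral
     by the $L^2$ norm. *)
  have : (0 <= \int[(mu \x mu)%E]_(z in cube a f `*` cube a f)
      ((u z.1 - u z.2) ^+ 2)%:E)%E.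
    by apply: integral_ge0 => z _; rewrite lee_fin sqr_ge0.
  rewrite (double_integral_sq_sub (mQ f) (Qfin f) mu_ (uQ f u Xu)).
  rewrite cube_measure //= -/q lee_fin => h.
  have hB : L2prod mu (cube a f) u u <= L2prod mu Omega u u.
    rewrite -lee_fin -(L2prod_EFin (mQ f) (uQ f u Xu)).
    rewrite -(L2prod_EFin mO (Xs_sqint_Omega mO Xu)) -(Xs_integral_Omega mO Xu).
    apply: ge0_subset_integral => //.
      by apply/measurable_EFinP; exact: measurable_funX.
    by move=> x _; rewrite lee_fin sqr_ge0.
  rewrite /l expr_div_n sqr_sqrtr ?(ltW q0) // ler_pdivrMr //.
  by move: h hB; set B := L2prod _ (cube _ _) _ _; nra.
- move=> u Xu; have [[mu_ u2] Du _] := (XsP _ _ _).1 Xu.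
  rewrite -lee_fin -(L2prod_EFin mO (Xs_sqint_Omega mO Xu)).
  have cov : Omega `<=` \bigcup_f @cube R N a m f.
    by move=> x Ox; have [f xf] := cube_cover a0 m0 (aP x Ox); exists f.
  have mu2 : measurable_fun setT (fun x => (u x ^+ 2)%:E).
    by apply/measurable_EFinP; exact: measurable_funX.
  have u2_ge0 x : (0 <= (u x ^+ 2)%:E)%E by rewrite lee_fin sqr_ge0.
  have hcov := integral_cover_le mu mQ tQ mu2 u2_ge0 mO cov.
  apply: (le_trans hcov).
  have hcube (f : {ffun 'I_N -> 'I_m}) := cube_poincare a0 m0 mu_ (uQ f u Xu) Du.
  apply: (le_trans (lee_sum _ (fun f _ => hcube f))).
  have mD2 : measurable_fun setT (fun z => (diffquot s u z ^+ 2)%:E).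
    by apply/measurable_EFinP; apply: measurable_funX; exact: Du.1.
  have D2_ge0 z : (0 <= (diffquot s u z ^+ 2)%:E)%E by rewrite lee_fin sqr_ge0.
  have tQQ : trivIset setT (fun f => @cube R N a m f `*` @cube R N a m f).
    by move=> f g _ _ [z [[zf _] [zg _]]]; apply: tQ => //; exists z.1.
  have := @sum_integral_le_setT _ _ R (mu \x mu)%E _ _ _
    (fun f => measurableX (mQ f) (mQ f)) tQQ mD2 D2_ge0.
  rewrite (L2prod_EFin measurableT Du) -XdotE => hD.
  rewrite big_split /= -ge0_sume_distrr; last first.
    by move=> f _; apply: integral_ge0 => z _.
  rewrite EFinD -/q sumEFin leeD2r // EFinM.
  have c0 : 0 <= c by rewrite divr_ge0 ?powR_ge0 // mulr_ge0 // ltW.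
  apply: (@le_trans _ _ (c%:E * (Xdot s u u)%:E)%E); first by rewrite lee_wpmul2l.
  rewrite -!EFinM lee_fin ler_wpM2r //.
  exact: (form_ge0 (Xdot_form s Omega)).
Qed.

End compactness.

(** * The Fucik functional *)

Section piecewise_quadratic.
Context {R : realType} (a b : R).

(* [fucik_potential] is the primitive of 2 * [fucik_slope]. *)
Definition fucik_slope (t : R) := b * Num.max t 0 - a * Num.max (- t) 0.

Definition fucik_potential (t : R) :=
  b * Num.max t 0 ^+ 2 + a * Num.max (- t) 0 ^+ 2.

(** This is Euler's identity for homogeneity of degree 2; with the weak equation tested on [u]
    itself, it gives $I(u)=0$. *)
Lemma fucik_potential_slope t : fucik_potential t = fucik_slope t * t.
Proof.
by rewrite /fucik_potential /fucik_slope; have [t0|t0] := leP t 0;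
  have [nt0|nt0] := leP (- t) 0; nra.
Qed.

Lemma fucik_potential_homo c t : 0 < c ->
  fucik_potential (c * t) = c ^+ 2 * fucik_potential t.
Proof.
move=> c0; rewrite /fucik_potential -mulrN.
rewrite -{1 2}(mulr0 c) -!maxr_pMr ?(ltW c0) //; ring.
Qed.

(** The slope has derivative [b] on the right of 0 and [a] on the left, both in [[lo, hi]], which
    bounds the second-order remainder. *)
Lemma fucik_potential_taylor lo hi t h : lo <= a <= hi -> lo <= b <= hi ->
  lo * h ^+ 2 <= fucik_potential (t + h) - fucik_potential t
    - 2 * (fucik_slope t * h) <= hi * h ^+ 2.
Proof.
move=> /andP[la ah] /andP[lb bh]; rewrite /fucik_potential /fucik_slope.
have maxE (x : R) : (0 <= x /\ Num.max x 0 = x /\ Num.max (- x) 0 = 0) \/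
    (x <= 0 /\ Num.max x 0 = 0 /\ Num.max (- x) 0 = - x).
  have /orP[x0|x0] := le_total 0 x; [left|right]; split => //.
    by split; [rewrite max_l|rewrite max_r // oppr_le0].
  by split; [rewrite max_r|rewrite max_l // oppr_ge0].
have h2 := sqr_ge0 h.
case: (maxE t) => -[t0 [-> ->]]; case: (maxE (t + h)) => -[th [-> ->]].
- by apply/andP; split; nra.
(* When [t] and [t + h] have opposite signs, the remainder is a combination of [a] and [b] with
   weights [(t + h) ^+ 2] and [h ^+ 2 - (t + h) ^+ 2], both nonnegative. *)
- have : 0 <= (h ^+ 2 - (t + h) ^+ 2) by nra.
  have := sqr_ge0 (t + h); set x := _ ^+ 2; move=> x0 y0.
  have : (b - lo) * (h ^+ 2 - x) >= 0 by rewrite mulr_ge0 // subr_ge0.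
  have : (hi - b) * (h ^+ 2 - x) >= 0 by rewrite mulr_ge0 // subr_ge0.
  have : (a - lo) * x >= 0 by rewrite mulr_ge0 // subr_ge0.
  have : (hi - a) * x >= 0 by rewrite mulr_ge0 // subr_ge0.
  by rewrite /x; move=> *; apply/andP; split; lra.
- have : 0 <= (h ^+ 2 - (t + h) ^+ 2) by nra.
  have := sqr_ge0 (t + h); set x := _ ^+ 2; move=> x0 y0.
  have : (a - lo) * (h ^+ 2 - x) >= 0 by rewrite mulr_ge0 // subr_ge0.
  have : (hi - a) * (h ^+ 2 - x) >= 0 by rewrite mulr_ge0 // subr_ge0.
  have : (b - lo) * x >= 0 by rewrite mulr_ge0 // subr_ge0.
  have : (hi - b) * x >= 0 by rewrite mulr_ge0 // subr_ge0.
  by rewrite /x; move=> *; apply/andP; split; lra.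
- by apply/andP; split; nra.
Qed.

End piecewise_quadratic.

Section functional.
Context {R : realType} {N : nat}.
Variables (s : R) (Omega : set 'rV[R]_N) (a b : R).
Hypothesis mO : measurable Omega.
Local Notation mu := (@lebesgue_rV R N).
Local Notation X := (Xs s Omega : set (('rV[R]_N -> R^o) : lmodType R)).
Local Notation g := (fucik_slope a b).
Local Notation G := (fucik_potential a b).
Local Notation J := (fun u : ('rV[R]_N -> R^o) => Ifun s Omega u a b).

Lemma sqint_fucik_slope u : sqint mu Omega u -> sqint mu Omega (fun x => g (u x)).
Proof.
move=> [mu_ u2].
have mp : measurable_fun Omega (u^\+) by exact: measurable_funrpos.
have mn : measurable_fun Omega (u^\-) by exact: measurable_funrneg.
have part (f : 'rV[R]_N -> R) : measurable_fun Omega f ->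
    (forall x, f x ^+ 2 <= u x ^+ 2) -> sqint mu Omega f.
  move=> mf fu; split => //; apply: (le_lt_trans _ u2).
  apply: ge0_le_integral => //.
  - by move=> x _; rewrite lee_fin sqr_ge0.
  - by apply/measurable_EFinP; exact: measurable_funX.
  - by apply/measurable_EFinP; exact: measurable_funX.
  - by move=> x _; rewrite lee_fin.
have p2 : sqint mu Omega (u^\+).
  by apply: part => // x; rewrite /funrpos; case: (leP (u x) 0) => _; nra.
have n2 : sqint mu Omega (u^\-).
  by apply: part => // x; rewrite /funrneg; case: (leP (- u x) 0) => _; nra.
have := sqint_lin mO b p2 (sqint_lin mO (- a) n2 (subspace0 (sqint_subspace mu mO))).
rewrite (_ : (fun x => _) = (fun x => g (u x))) //.
apply/funext => x; rewrite /fucik_slope /funrpos /funrneg.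
by rewrite -[X in _ + (_ + X)]/(0 : R); ring.
Qed.

Let potE (u : 'rV[R]_N -> R) x : b * u^\+ x ^+ 2 + a * u^\- x ^+ 2 = g (u x) * u x.
Proof. exact: fucik_potential_slope. Qed.

Lemma Ifun_double u : X u ->
  2 * J u = Xdot s u u - \int[mu]_(x in Omega) (g (u x) * u x).
Proof.
move=> Xu; rewrite /Ifun (Xnorm_sqr Xu) mulrBr !mulrA mulfV ?pnatr_eq0 // !mul1r.
by congr (_ - _); apply: eq_Rintegral => x _; exact: potE.
Qed.

Lemma Ifun_homo c u : 0 < c -> X u -> J (c *: u) = c ^+ 2 * J u.
Proof.
move=> c0 Xu; have sX := Xs_subspace s Omega.
have Xcu : X (c *: u) by exact: (subspaceZ sX).
have uO := Xs_sqint_Omega mO Xu.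
suff : 2 * J (c *: u) = c ^+ 2 * (2 * J u) by lra.
rewrite !Ifun_double // (form_sqZ sX (Xdot_form s Omega)) // mulrBr; congr (_ - _).
rewrite -RintegralZl //; last by apply: sqint_mul => //; exact: sqint_fucik_slope.
apply: eq_Rintegral => x _; rewrite -!fucik_potential_slope.
exact: fucik_potential_homo.
Qed.

(** The weak equation, tested on [u] and on [h], cancels the terms of order 0 and 1. What remains is
    the form at [h] minus the integrated Taylor remainder. *)
Lemma Ifun_expansion lo hi u : lo <= a <= hi -> lo <= b <= hi -> X u ->
  (forall v, X v -> Xdot s u v = \int[mu]_(x in Omega) (g (u x) * v x)) ->
  forall h, X h ->
  Xdot s h h - hi * L2prod mu Omega h h <= 2 * J (u + h) <=
  Xdot s h h - lo * L2prod mu Omega h h.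
Proof.
move=> la lb Xu crit h Xh; have sX := Xs_subspace s Omega.
have fD := Xdot_form s Omega.
have Xuh : X (u + h) by exact: (subspaceD sX).
have uO := Xs_sqint_Omega mO Xu; have hO := Xs_sqint_Omega mO Xh.
have uhO := Xs_sqint_Omega mO Xuh.
have iuh := sqint_mul mO (sqint_fucik_slope uhO) uhO.
have iu := sqint_mul mO (sqint_fucik_slope uO) uO.
have ih := sqint_mul mO (sqint_fucik_slope uO) hO.
have ihh := sqint_mul mO hO hO.
rewrite Ifun_double // (form_sqD sX fD) // crit // crit //.
have ZE c (f : 'rV[R]_N -> R) : mu.-integrable Omega (EFin \o f) ->
    mu.-integrable Omega (EFin \o (fun x => c * f x)).
  move=> fi; rewrite (_ : EFin \o _ = (fun x => c%:E * (f x)%:E)%E) //.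
  exact: integrableZl.
have BE (f f' : 'rV[R]_N -> R) : mu.-integrable Omega (EFin \o f) ->
    mu.-integrable Omega (EFin \o f') ->
    mu.-integrable Omega (EFin \o (fun x => f x - f' x)).
  move=> fi f'i; rewrite (_ : EFin \o _ = (fun x => (f x)%:E - (f' x)%:E)%E) //.
  exact: integrableB.
have iB := BE _ _ iuh iu; have iBB := BE _ _ iB (ZE 2 _ ih).
have E : \int[mu]_(x in Omega) (g ((u + h) x) * (u + h) x - g (u x) * u x
      - 2 * (g (u x) * h x)) =
    \int[mu]_(x in Omega) (g ((u + h) x) * (u + h) x)
    - \int[mu]_(x in Omega) (g (u x) * u x)
    - 2 * \int[mu]_(x in Omega) (g (u x) * h x).
  rewrite RintegralB //; last exact: ZE.
  by rewrite RintegralB // RintegralZl.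
have lo_le : lo * L2prod mu Omega h h <= \int[mu]_(x in Omega)
    (g ((u + h) x) * (u + h) x - g (u x) * u x - 2 * (g (u x) * h x)).
  rewrite /L2prod -RintegralZl //; apply: le_Rintegral => //; first exact: ZE.
  move=> x _; rewrite -!fucik_potential_slope -expr2.
  by have /andP[] := fucik_potential_taylor (u x) (h x) la lb.
have hi_ge : \int[mu]_(x in Omega)
    (g ((u + h) x) * (u + h) x - g (u x) * u x - 2 * (g (u x) * h x)) <=
    hi * L2prod mu Omega h h.
  rewrite /L2prod -RintegralZl //; apply: le_Rintegral => //; first exact: ZE.
  move=> x _; rewrite -!fucik_potential_slope -expr2.
  by have /andP[] := fucik_potential_taylor (u x) (h x) la lb.
by move: lo_le hi_ge; rewrite E => *; apply/andP; split; lra.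
Qed.

End functional.

(** * Application to the region between the two curves *)

Lemma Nspace_eigsum (R : realType) (N : nat) (s : R) (Omega : set 'rV[R]_N)
    (lam : nat -> R) (j : nat) :
  Nspace s Omega lam j = eigsum (V := ('rV[R]_N -> R^o)) (Xs s Omega) (Xdot s)
    (L2prod (@lebesgue_rV R N) Omega) lam j.
Proof.
by apply/seteqP; split => u [e Ee ->]; exists e => //; rewrite fct_sumE.
Qed.

Lemma Mspace_eigsum_orth (R : realType) (N : nat) (s : R) (Omega : set 'rV[R]_N)
    (lam : nat -> R) (j : nat) :
  Mspace s Omega lam j = eigsum_orth (V := ('rV[R]_N -> R^o)) (Xs s Omega)
    (Xdot s) (L2prod (@lebesgue_rV R N) Omega) lam j.
Proof. by rewrite /Mspace Nspace_eigsum. Qed.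

Theorem mainTheorem4 (R : realType) (N : nat) (s : R)
    (Omega : set 'rV[R]_N) (lam : nat -> R) (k : nat)
    (hs : 0 < s < 1) (hN : 2 * s < N%:R)
    (hOmega : bounded_domain Omega) (hLip : lipschitz_boundary Omega)
    (hlam : eigenvalue_sequence s Omega lam)
    (hk : (2 <= k)%N)
    (hsimple : simple_eigenvalue s Omega (lam k)) :
  region_II s Omega lam k `&` dancer_fucik s Omega = set0.
Proof.
rewrite -subset0 => -[a b] [[[/= /andP[a1 a2] /andP[b1 b2]] [nu_b b_mu]]].
move=> [u [Xu u_neq0] u_crit] /=.
have [oO _ _ bO] := hOmega; have mO := open_measurable_rV oO.
have [s0 _] := andP hs.
have [lam1 lam_lt lam_all] := hlam.
have sX := Xs_subspace s Omega; have fD := Xdot_form s Omega.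
have fL := L2prod_Xs_form s mO; have XC := @Xs_complete R N s Omega mO.
have XK := Xs_compact s0 mO bO.
(* The index [j] is $k-1$; since $k\ge2$ it is positive, so [lam j] is an actual eigenvalue. *)
have [j k_eq j0] : exists2 j, k = j.+1 & (0 < j)%N.
  by case: k hk {hsimple a1 a2 b1 b2 nu_b b_mu} => [|[|j]] // _; exists j.+1.
subst k; rewrite /= in a1 b1.
(* Otherwise [b] would belong to the set whose supremum is [nu_lower], which is less than [b];
   [m_pos] follows in the same way from [mu_upper]. *)
have n_neg : (n_val s Omega lam j a b < 0)%E.
  rewrite ltNge; apply/negP => n_ge0; move: nu_b; rewrite ltNge => /negP; apply.
  by apply: ereal_sup_ubound; exists b => //=; rewrite b1 b2.
have m_pos : (0 < m_val s Omega lam j.+1 a b)%E.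
  rewrite ltNge; apply/negP => m_le0; move: b_mu; rewrite ltNge => /negP; apply.
  by apply: ereal_inf_lbound; exists b => //=; rewrite b1 b2.
have [_ [z [Mz _] <-] z_neg] := ereal_inf_lt n_neg.
have [_ [p [Np _] <-] p_pos] := ereal_sup_gt m_pos.
have [e [Ee _ eP]] := hsimple.2.
have lam_all' c : (exists2 u, eigenset (Xs s Omega) (Xdot s)
    (L2prod (@lebesgue_rV R N) Omega) (Xs s Omega) c u &
    0 < L2prod (@lebesgue_rV R N) Omega u u) ->
    exists2 i, (0 < i)%N & lam i = c.
  move=> [v Ev v_gt0]; apply/lam_all; exists v => // v0.
  by move: v_gt0; rewrite (@ae_zero_L2prod R N s Omega mO) ?ltxx //; exact: Ev.1.
have mab : Num.min a b <= a <= Num.max a b by rewrite ge_min le_max lexx.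
have mba : Num.min a b <= b <= Num.max a b by rewrite ge_min le_max lexx !orbT.
have lo_gt : lam j < Num.min a b by rewrite lt_min a1.
have hi_lt : Num.max a b < lam j.+2 by rewrite gt_max a2.
apply: (@saddle_no_critical_point _ ('rV[R]_N -> R^o) _ _ _ _ sX fD fL XC XK
  lam1 lam_lt lam_all' (fun v => Ifun s Omega v a b) _ _ j u z p (e ord0)
  j0 lo_gt hi_lt).
- by move=> c x c0 Xx; exact: Ifun_homo.
(* The zero function solves the equation, so the expansion at a critical point covers [J0] too. *)
- move=> h Xh.
  have := Ifun_expansion mO mab mba (subspace0 sX) _ Xh.
  rewrite add0r; apply => v Xv.
  rewrite (form0l sX fD) // /Rintegral; apply/esym.
  rewrite (eq_integral (cst 0%E)) ?integral0 // => x _.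
  by rewrite -[(0 : 'rV[R]_N -> R^o) x]/(0 : R) /fucik_slope oppr0 maxxx
    !mulr0 subrr mul0r.
- exact: Ifun_expansion u_crit.
- exact: Ee.
- move=> f Ef; have [c cP] := eP f Ef; exists (c ord0).
  have Xh : Xs s Omega (f - (c ord0 : R) *: (e ord0 : 'rV[R]_N -> R^o)).
    apply: (subspaceB sX); first exact: Ef.1.
    by apply: (subspaceZ sX); exact: (Ee ord0).1.
  apply: (@ae_zero_L2prod R N s Omega mO) => //.
  by apply: filterS cP => x; rewrite big_ord1.
- exact: Xu.
- by apply/eqP => u0; apply: u_neq0; exact: (L2prod_ae_zero mO Xu).
- by rewrite -Mspace_eigsum_orth.
- move=> v; rewrite -Nspace_eigsum => Nv; rewrite -lte_fin.
  by apply: le_lt_trans z_neg; apply: ereal_sup_ubound; exists v.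
- by rewrite -Nspace_eigsum.
- move=> w; rewrite -Mspace_eigsum_orth => Mw; rewrite -lte_fin.
  by apply: (lt_le_trans p_pos); apply: ereal_inf_lbound; exists w.
Qed.
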